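(* For each $\iota>0$, there is $D_0$ such that if $D\ge D_0$ and $\mathcal{H}$ is a $3$-uniform $3$-simple hypergraph with maximum degree at most $D$, then $$\chi'(\mathcal{H}) \le \left(1-\frac{1}{9}+\frac{1}{3^5}+\iota\right)3D.$$ In particular, for all sufficiently large $D$, every $3$-uniform $3$-simple hypergraph with maximum degree at most $D$ has chromatic index at most $2.6791\,D$.
   Context: A hypergraph $\mathcal{H}$ consists of a vertex set $V(\mathcal{H})$ and a multiset $E(\mathcal{H})$ of edges, each a subset of $V(\mathcal{H})$ (repeated edges are allowed and copies count as distinct edges). It is $k$-uniform if every edge has size $k$, and $t$-simple if every two distinct edges intersect in at most $t$ vertices (so for a $3$-uniform hypergraph, being $3$-simple is no restriction). The degree of a vertex is the number of edges (with multiplicity) containing it. The chromatic index $\chi'(\mathcal{H})$ is the smallest number of colors needed to color the edges of $\mathcal{H}$ so that any two distinct intersecting edges receive distinct colors. *)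

(* Defs.v *)
From mathcomp Require Import all_boot all_order all_algebra reals.

Set Implicit Arguments.
Unset Strict Implicit.
Unset Printing Implicit Defensive.

(* The multiset of edges is a family of vertex sets indexed by the finite type
   [edge H]: two indices with the same image under [ends] are two distinct
   copies of a repeated edge. *)
Record hypergraph := Hypergraph {
  vertex : finType;
  edge : finType;
  ends : edge -> {set vertex}
}.
Arguments ends : clear implicits.

Definition k_uniform (k : nat) (H : hypergraph) : Prop :=
  forall e : edge H, #|ends H e| = k.

Definition t_simple (t : nat) (H : hypergraph) : Prop :=
  forall e f : edge H, e != f -> #|ends H e :&: ends H f| <= t.

Definition degree (H : hypergraph) (v : vertex H) : nat :=
  #|[set e : edge H | v \in ends H e]|.

Definition max_degree (H : hypergraph) : nat :=
  \max_(v : vertex H) degree v.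

Definition proper_edge_coloring (H : hypergraph) (k : nat)
    (c : {ffun edge H -> 'I_k}) : bool :=
  [forall e, forall f,
    (e != f) && (ends H e :&: ends H f != set0) ==> (c e != c f)].

Definition edge_colorable (H : hypergraph) (k : nat) : bool :=
  [exists c : {ffun edge H -> 'I_k}, proper_edge_coloring c].

Lemma edge_colorable_exists (H : hypergraph) : exists k, edge_colorable H k.
Proof.
exists #|edge H|; apply/existsP; exists [ffun e => enum_rank e].
apply/forallP => e; apply/forallP => f; apply/implyP => /andP[neq_ef _].
by rewrite !ffunE (inj_eq enum_rank_inj).
Qed.

Definition chromatic_index (H : hypergraph) : nat :=
  ex_minn (edge_colorable_exists H).

(* Main.v *)
(* Every edge of a 3-uniform hypergraph of maximum degree D meets at most 3D - 3
   others.  Label the edges at random and let M1 be the edges whose label is a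
   local minimum (after padding, each edge has probability about 1/3D).  Two
   disjoint edges are both in M1 with probability at least about 1/(3D)^2, and more
   if they have many common neighbours; since a given edge e meets many disjoint
   pairs of edges, several edges of M1 often meet e, and hence, E|M1 n N[e]| being
   at most 1, with probability at least about 0.12 no edge of M1 meets e.  A second
   round of local minima among these free edges gives a random matching that contains
   each edge with probability at least 1.1208/(3D) and is determined locally.
   Taking T = 75m independent copies, with m a small constant multiple of D, every
   vertex of degree more than D - 28m sees more than 28m distinct edges of their union
   with probability 1 - exp(-cD), so by the local lemma T colours can lower the
   maximum degree by 28m.  Iterating, the chromatic index is at most (75/28)D + O(1),
   and 75/28 < 217/81 = 3(1 - 1/9 + 1/3^5). *)
Require Import Defs.
From mathcomp Require Import all_boot all_order all_algebra reals.
From mathcomp Require Import ring lra zify.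

Set Implicit Arguments.
Unset Strict Implicit.
Unset Printing Implicit Defensive.

Import Order.TTheory GRing.Theory Num.Theory.
Local Open Scope ring_scope.

(** * Expectation over finite spaces and independent labels *)


(** Write [N = 3D], [a = |N[e]|], [y = N - a]. If two disjoint edges have padded neighbourhoods with
    a union of size [U], both are local minima with probability about [2 / (N U)]. Pairs minus
    triples then leave [e] free with probability about [1 - a / N + gain / N], where [gain] sums
    [(1 - t / U) / U] over ordered disjoint pairs in [N[e]], and [t] counts the edges of [N[e]]
    disjoint from both. The obstacle is the edges meeting [e] in several vertices, repeated copies
    included: they spoil the count of disjoint pairs. Each of them adds to [y], and all their damage
    is linear in [y]. This is affordable because the free probability need only be proportional to
    [a]: in the second round [e] competes with at most [a] labels. Two rounds give every edge
    probability at least [467 / 1250 / D], and [75 / 28] lies strictly between [1250 / 467] and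
    [217 / 81]. Labels are integers below a large [K], so that probabilities are counts over a
    finite type; ties cost [O(1 / K)]. *)

Section Expectation.
Variables (R : realFieldType) (Om : finType).

Definition expect (f : Om -> R) : R := (\sum_w f w) / #|Om|%:R.

Definition prob (A : pred Om) : R := expect (fun w => (A w)%:R).

Lemma eq_expect f g : f =1 g -> expect f = expect g.
Proof. by move=> fg; rewrite /expect; congr (_ / _); apply: eq_bigr => w _. Qed.

Lemma eq_prob (A B : pred Om) : A =1 B -> prob A = prob B.
Proof. by move=> AB; apply: eq_expect => w; rewrite AB. Qed.

Lemma expectD f g : expect (fun w => f w + g w) = expect f + expect g.
Proof. by rewrite /expect big_split mulrDl. Qed.

Lemma expectN f : expect (fun w => - f w) = - expect f.
Proof. by rewrite /expect sumrN mulNr. Qed.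

Lemma expectB f g : expect (fun w => f w - g w) = expect f - expect g.
Proof. by rewrite expectD expectN. Qed.

Lemma expectZ c f : expect (fun w => c * f w) = c * expect f.
Proof. by rewrite /expect -mulr_sumr mulrA. Qed.

Lemma expect_sum (I : Type) (r : seq I) (P : pred I) (F : I -> Om -> R) :
  expect (fun w => \sum_(i <- r | P i) F i w) = \sum_(i <- r | P i) expect (F i).
Proof. by rewrite /expect exchange_big /= mulr_suml. Qed.

Lemma le_expect f g : (forall w, f w <= g w) -> expect f <= expect g.
Proof.
move=> fg; rewrite /expect ler_wpM2r ?invr_ge0 ?ler0n //.
by apply: ler_sum => w _.
Qed.

Lemma expect_ge0 f : (forall w, 0 <= f w) -> 0 <= expect f.
Proof. by move=> f0; rewrite mulr_ge0 ?invr_ge0 ?ler0n ?sumr_ge0. Qed.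

Lemma prob_ge0 A : 0 <= prob A.
Proof. by apply: expect_ge0 => w; rewrite ler0n. Qed.

Lemma le_prob (A B : pred Om) : (forall w, A w -> B w) -> prob A <= prob B.
Proof.
by move=> AB; apply: le_expect => w; rewrite ler_nat; case: (A w) (AB w) => // ->.
Qed.

Hypothesis Om_gt0 : (0 < #|Om|)%N.

Lemma expect_const c : expect (fun=> c) = c.
Proof.
by rewrite /expect sumr_const -[c *+ _]mulr_natr mulfK // pnatr_eq0 -lt0n.
Qed.

Lemma probT (A : pred Om) : (forall w, A w) -> prob A = 1.
Proof.
move=> AT; rewrite -[RHS]expect_const; apply: eq_expect => w; by rewrite AT.
Qed.

Lemma prob_le1 A : prob A <= 1.
Proof. by rewrite -(@probT predT) //; apply: le_prob. Qed.

Lemma prob_exists (A : pred Om) : 0 < prob A -> exists w, A w.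
Proof.
move=> A0; case: (pickP A) => [w Aw|nA]; first by exists w.
move: A0; rewrite (@eq_prob _ (fun=> false)) // /prob expect_const ltxx //.
Qed.

End Expectation.

Section Product.
Variables (R : realFieldType) (L : finType) (K : nat).
Hypothesis K_gt0 : (0 < K)%N.
Local Notation Om := {ffun L -> 'I_K}.

Lemma card_labels_gt0 : (0 < #|{: Om}|)%N.
Proof. by rewrite card_ffun card_ord expn_gt0 K_gt0. Qed.

Definition depends_on (T : Type) (X : {set L}) (f : Om -> T) :=
  forall l1 l2 : Om, (forall z, z \in X -> l1 z = l2 z) -> f l1 = f l2.

Lemma depends_onS (T : Type) (X Y : {set L}) (f : Om -> T) :
  X \subset Y -> depends_on X f -> depends_on Y f.
Proof. by move=> /subsetP XY fX l1 l2 e; apply: fX => z /XY; apply: e. Qed.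

(* Swapping the coordinates outside [X] between two independent samples [a] and [b]
   preserves their joint law and replaces [f a * g b] by [f a * g a]. *)
Lemma expectM_indep (X Y : {set L}) (f g : Om -> R) :
    depends_on X f -> depends_on Y g -> [disjoint X & Y] ->
  expect (fun l => f l * g l) = expect f * expect g.
Proof.
move=> fX gY dXY.
pose mix (a b : Om) : Om := [ffun z => if z \in X then a z else b z].
have fmix a b : f (mix a b) = f a by apply: fX => z zX; rewrite ffunE zX.
have gmix a b : g (mix b a) = g a.
  apply: gY => z zY; rewrite ffunE; case: ifP => // zX.
  by move/pred0P/(_ z): dXY => /=; rewrite zX zY.
pose h (p : Om * Om) := (mix p.1 p.2, mix p.2 p.1).
have hK : involutive h.
  by case=> a b; rewrite /h /mix /=; congr (_, _); apply/ffunP=> z;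
     rewrite !ffunE; case: (z \in X).
have Om0 : #|{: Om}|%:R != 0 :> R by rewrite pnatr_eq0 -lt0n card_labels_gt0.
suff H : (\sum_l f l * g l) * #|{: Om}|%:R = (\sum_l f l) * (\sum_l g l).
  by rewrite /expect mulf_div -H invfM mulrA mulfK.
apply/esym.
transitivity (\sum_(p : Om * Om) f p.1 * g p.2).
  rewrite -(pair_bigA _ (fun a b => f a * g b)) /= mulr_suml.
  by apply: eq_bigr => a _; rewrite mulr_sumr.
rewrite (reindex_inj (inv_inj hK)) /=.
transitivity (\sum_(a : Om) \sum_(b : Om) f a * g a).
  rewrite pair_bigA; apply: eq_bigr => -[a b] _ /=.
  by rewrite fmix gmix.
by rewrite mulr_suml; apply: eq_bigr => a _; rewrite sumr_const mulr_natr.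
Qed.

Lemma probM_indep (X Y : {set L}) (A B : pred Om) :
    depends_on X A -> depends_on Y B -> [disjoint X & Y] ->
  prob R (fun l : Om => A l && B l) = prob R A * prob R B.
Proof.
move=> AX BY dXY; rewrite /prob -(@expectM_indep X Y) //.
- by apply: eq_expect => l; case: (A l); rewrite /= ?mul1r ?mul0r.
- by move=> l1 l2 /AX ->.
- by move=> l1 l2 /BY ->.
Qed.

Lemma expect_prod (w : L -> 'I_K -> R) :
  expect (fun l : Om => \prod_z w z (l z)) = \prod_z ((\sum_v w z v) / K%:R).
Proof.
rewrite /expect -bigA_distr_bigA big_split /= prodr_const card_ffun card_ord.
by rewrite exprVn natrX.
Qed.

(** The bound counts admissible values from the top: for [b <= K] the event has probability
    [(b / K)^|Y|], the discrete analogue of labels in [[0, 1]] lying above [1 - b / K]. *)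
Definition labels_from (Y : {set L}) (b : nat) : pred Om :=
  fun l => [forall z in Y, K - b <= l z]%N.

Lemma labels_from_dep Y b : depends_on Y (labels_from Y b).
Proof. by move=> l1 l2 e; apply: eq_forallb_in => z zY; rewrite e. Qed.

Lemma prob_labels_from (x : L) (Y : {set L}) (b : nat) (v : 'I_K) :
    (b <= K)%N -> x \notin Y ->
  prob R (fun l : Om => (l x == v) && labels_from Y b l)
    = K%:R^-1 * (b%:R / K%:R) ^+ #|Y|.
Proof.
move=> bK xY.
pose w z (u : 'I_K) : R :=
  if z == x then (u == v)%:R else if z \in Y then (K - b <= u)%N%:R else 1.
have K0 : K%:R != 0 :> R by rewrite pnatr_eq0 -lt0n.
transitivity (expect (fun l : Om => \prod_z w z (l z))).
  apply: eq_expect => l; rewrite (bigD1 x) //= {1}/w eqxx.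
  case: eqP => _; rewrite ?mul0r // mul1r /=.
  have -> : \prod_(i | i != x) w i (l i) = \prod_(i in Y) (K - b <= l i)%N%:R.
    rewrite [LHS](bigID (mem Y)) /= [X in _ * X]big1 ?mulr1; last first.
      by move=> i /andP[ix iY]; rewrite /w (negPf ix) (negPf iY).
    apply: eq_big => [i|i /andP[ix iY]].
      by rewrite andb_idl // => iY; apply: contraNneq xY => <-.
    by rewrite /w (negPf ix) iY.
  rewrite /labels_from; case: (boolP [forall z in Y, _]) => [/forall_inP a|].
    by rewrite big1 // => i /a ->.
  rewrite negb_forall => /existsP[z]; rewrite negb_imply => /andP[zY nz].
  by rewrite (bigD1 z) //= (negPf nz) mul0r.
rewrite expect_prod (bigD1 x) //= /w eqxx (bigD1 v) //= eqxx big1; last first.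
  by move=> u /negPf ->.
rewrite addr0 mul1r; congr (_ * _).
rewrite (bigID (mem Y)) /= [X in _ * X]big1 ?mulr1; last first.
  move=> i /andP[ix iY]; rewrite (negPf ix) (negPf iY) sumr_const card_ord.
  by rewrite divff.
rewrite -prodr_const.
apply: eq_big => [i|i /andP[ix iY]].
  by rewrite andb_idl // => iY; apply: contraNneq xY => <-.
rewrite (negPf ix) iY; congr (_ / _).
rewrite -natr_sum; congr _%:R.
rewrite -(big_mkord xpredT (fun u => (K - b <= u)%N : nat)).
rewrite (@big_cat_nat _ _ _ (K - b)%N) //= ?leq_subr //.
rewrite big_nat_cond big1 ?add0n => [|u]; last first.
  by rewrite andbT => /andP[_ uK]; rewrite leqNgt uK.
rewrite big_nat_cond (eq_bigr (fun=> 1%N)) => [|u /andP[/andP[-> _] _] //].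
by rewrite -big_nat_cond sum_nat_const_nat muln1 subKn.
Qed.

End Product.

(** * Local minima of random labels *)


(** The increment of [x^(n+1)] over [[a, a+1]] lies between the values of its derivative at the two
    ends. Summed, these bounds replace the integral of [x^n]. *)
Lemma expn_succ_ge n a : (a ^ n.+1 + n.+1 * a ^ n <= a.+1 ^ n.+1)%N.
Proof.
elim: n => [|n IHn]; first by rewrite expn0 !expn1; lia.
rewrite [leqRHS]expnS; apply: leq_trans (leq_mul (leqnn a.+1) IHn).
by rewrite !expnS; nia.
Qed.

Lemma expn_succ_le n a : (a.+1 ^ n.+1 <= a ^ n.+1 + n.+1 * a.+1 ^ n)%N.
Proof.
elim: n => [|n IHn]; first by rewrite expn0 !expn1; lia.
rewrite expnS mulSn addnC.
apply: leq_trans (leq_add (leq_mul (leqnn a) IHn) (leqnn _)) _.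
by rewrite !expnS; nia.
Qed.

Lemma sum_expn_le n a : (n.+1 * (\sum_(b < a) b ^ n) <= a ^ n.+1)%N.
Proof.
elim: a => [|a IHa]; first by rewrite big_ord0 muln0.
rewrite big_ord_recr /= mulnDr; apply: leq_trans (expn_succ_ge n a).
by rewrite leq_add2r.
Qed.

(** Comparison with the integral from below shifts the argument by one, hence [m.+1]; along a chain
    of minima the shifts add up to its length. *)
Lemma sum_expn_ge m n a : ((a - m.+1) ^ n.+1 <= n.+1 * (\sum_(b < a) (b - m) ^ n))%N.
Proof.
elim: a => [|a IHa]; first by rewrite sub0n exp0n.
rewrite big_ord_recr /= mulnDr subSS; apply: leq_trans (leq_add IHa (leqnn _)).
rewrite subnS; case: (a - m)%N => [|d] /=; first by rewrite exp0n.
exact: expn_succ_le.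
Qed.

Section Chain.
Variables (R : realFieldType) (L : finType) (K : nat).
Hypothesis K_gt0 : (0 < K)%N.
Local Notation Om := {ffun L -> 'I_K}.
Implicit Types (l : Om) (x y z : L) (X Y Z : {set L}) (s : seq (L * {set L})).

Definition strict_min l x X := [forall y in X, (y != x) ==> (l x < l y)%N].

Lemma strict_min_dep x X Z :
  x \in Z -> X \subset Z -> depends_on Z (fun l => strict_min l x X).
Proof.
move=> xZ /subsetP XZ l1 l2 e; rewrite /strict_min.
by apply: eq_forallb_in => z /XZ zZ; rewrite !e.
Qed.

Definition chain_min s l := all (fun p => strict_min l p.1 p.2) s.

Definition top s : {set L} := if s is p :: _ then p.2 else set0.

(** The sets shrink along the list and each minimum lies outside the next set. With continuous
    labels the minimality events would then be independent, of total probability the product of the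
    [1 / |p.2|]. *)
Fixpoint nested s :=
  if s is p :: s' then
    [&& p.1 \in p.2, p.1 \notin top s', top s' \subset p.2 & nested s']
  else true.

Lemma chain_min_dep s : nested s -> depends_on (top s) (chain_min s).
Proof.
elim: s => [|[x X] s IHs] //= /and4P[xX xs sX ns] l1 l2 e.
congr (_ && _); first exact: (strict_min_dep xX (subxx X)).
by apply: IHs => // z zs; apply/e/(subsetP sX).
Qed.

(* The label of [x] is [K - b.+1] for some [b < a]; the labels of the rest of [X] are
   then at least [K - b], independently outside and inside [top s]. *)
Lemma prob_chain_rec x X s (a : nat) :
    nested ((x, X) :: s) -> (a <= K)%N ->
  prob R (fun l => labels_from X a l && chain_min ((x, X) :: s) l) =
  \sum_(b < a) K%:R^-1 * (b%:R / K%:R) ^+ (#|X| - #|top s|).-1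
     * prob R (fun l => labels_from (top s) b l && chain_min s l).
Proof.
move=> /and4P[/= xX xs sX ns] aK.
pose Y := X :\: top s :\ x.
pose v (b : 'I_a) : 'I_K := rev_ord (widen_ord aK b).
pose A b l := (l x == v b) && labels_from Y b l.
pose B b l := labels_from (top s) b l && chain_min s l.
have memX z : z \in X = [|| z == x, z \in Y | z \in top s].
  rewrite !inE; case: eqP => [->|_] //=.
  by have := subsetP sX z; case: (z \in top s) => [->|_] //; case: (z \in X).
transitivity (expect (fun l => \sum_(b < a) (A b l && B b l)%:R : R)).
  apply: eq_expect => l.
  pose c := [&& labels_from X a l, strict_min l x X & chain_min s l].
  transitivity (c%:R : R); first by [].
  have AB b : A b l && B b l = (l x == v b) && c.
    rewrite /A /B -!andbA; case: eqP => //= lx.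
    rewrite /c /= !andbA; congr (_ && _).
    have bK : (b < K)%N by exact: leq_trans (ltn_ord b) aK.
    have lxE : l x = (K - b.+1)%N :> nat by rewrite lx.
    apply/andP/andP => -[/forall_inP p1 /forall_inP p2].
      split; apply/forall_inP => z; rewrite memX => /or3P[/eqP->|zY|zs].
      - by rewrite lxE leq_sub2l.
      - by apply: leq_trans (p1 _ zY); rewrite leq_sub2l // ltnW.
      - by apply: leq_trans (p2 _ zs); rewrite leq_sub2l // ltnW.
      - by rewrite eqxx.
      - by apply/implyP => _; have := p1 _ zY; rewrite lxE; lia.
      - by apply/implyP => _; have := p2 _ zs; rewrite lxE; lia.
    have key z : z \in X -> z != x -> (K - b <= l z)%N.
      by move=> zX zx; move: (p2 _ zX); rewrite zx /= lxE -subSn // subSS.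
    split; apply/forall_inP => z zZ; apply: key; rewrite ?memX ?zZ ?orbT //.
      by move: zZ; rewrite !inE => /andP[].
    by apply: contraNneq xs => <-.
  case: (boolP c) => [cT|cF]; last first.
    by rewrite big1 // => b _; rewrite AB (negPf cF) andbF.
  have lxa : (K - (l x).+1 < a)%N.
    have /andP[/forall_inP/(_ _ xX) lx _] := cT.
    by have lxK := ltn_ord (l x); rewrite -subSn // subSS leq_subCl.
  have lxv : l x == v (Ordinal lxa).
    by apply/eqP/val_inj => /=; rewrite -subSn ?ltn_ord // subSS subKn // ltnW.
  rewrite (bigD1 (Ordinal lxa)) //= AB lxv cT /= big1 ?addr0 // => b bx.
  rewrite AB (eqP lxv); case: eqP => // /rev_ord_inj/(congr1 val)/= e.
  by case/eqP: bx; apply/val_inj/esym.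
rewrite expect_sum; apply: eq_bigr => b _.
rewrite -[LHS]/(prob R (fun l => A b l && B b l)).
have xY : x \notin Y by rewrite !inE eqxx.
have dAB : [disjoint x |: Y & top s].
  rewrite disjoints_subset; apply/subsetP => z; rewrite !inE.
  by case: eqP => [->|_] //= /andP[].
rewrite (@probM_indep R L K K_gt0 (x |: Y) (top s)) //; last 2 first.
- move=> l1 l2 e; rewrite /A e ?setU11 //; congr (_ && _).
  by apply: labels_from_dep => z zY; rewrite e // setU1r.
- move=> l1 l2 e; rewrite /B; congr (_ && _); last exact: chain_min_dep.
  exact: labels_from_dep.
have bK : (b <= K)%N by exact: leq_trans (ltnW (ltn_ord b)) aK.
rewrite prob_labels_from //; congr (_ * _ ^+ _ * _).
have := cardsD1 x (X :\: top s); rewrite cardsD (setIidPr sX) inE xX xs /= -/Y.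
by move=> ->.
Qed.

Lemma nested_card x X s : nested ((x, X) :: s) -> (#|top s| < #|X|)%N.
Proof.
case/and4P => /= xX xs sX _; apply: proper_card; apply/properP; split => //.
by exists x.
Qed.

(** The event [labels_from (top s) a] makes the induction run: once the label of the head is fixed,
    the tail is a chain among the labels above it. Summing over that label produces the factor
    [1 / |X|]. *)
Lemma prob_chain_le s (a : nat) :
    nested s -> (a <= K)%N ->
  prob R (fun l => labels_from (top s) a l && chain_min s l)
    <= (a%:R / K%:R) ^+ #|top s| / (\prod_(p <- s) #|p.2|)%:R.
Proof.
elim: s a => [|[x X] s IHs] a ns aK.
  by rewrite big_nil cards0 expr0 divr1 prob_le1 // card_labels_gt0.
rewrite prob_chain_rec // big_cons.
have := nested_card ns; move: (ns) => /and4P[_ _ _ ns'] /=.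
set n := #|X|; set n' := #|top s|; set q := (\prod_(_ <- _) _)%N => n'n.
have n0 : (0 < n)%N by case: n n'n.
have K0 : 0 < K%:R :> R by rewrite ltr0n.
apply: (@le_trans _ _
    (\sum_(b < a) K%:R^-1 * ((b%:R / K%:R) ^+ n.-1 / q%:R))).
  apply: ler_sum => b _; rewrite -mulrA ler_wpM2l ?invr_ge0 ?ler0n //.
  have bK : (b <= K)%N by exact: leq_trans (ltnW (ltn_ord b)) aK.
  have -> : n.-1 = ((n - n').-1 + n')%N by lia.
  rewrite exprD -mulrA ler_wpM2l ?IHs //.
  by rewrite exprn_ge0 // divr_ge0 ?ler0n.
rewrite -mulr_sumr -mulr_suml natrM invfM !mulrA ler_wpM2r ?invr_ge0 ?ler0n //.
rewrite ler_pdivlMr ?ltr0n //.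
have -> : \sum_(b < a) (b%:R / K%:R) ^+ n.-1
   = (\sum_(b < a) b ^ n.-1)%N%:R / K%:R ^+ n.-1 :> R.
  by rewrite natr_sum mulr_suml; apply: eq_bigr => b _; rewrite expr_div_n natrX.
move: (prednK n0); move: n.-1 => p <-.
rewrite [X in X <= _](_ : _ = (p.+1 * \sum_(b < a) b ^ p)%N%:R / K%:R ^+ p.+1).
  rewrite expr_div_n ler_wpM2r ?invr_ge0 ?exprn_ge0 ?ler0n //.
  by rewrite -natrX ler_nat sum_expn_le.
by rewrite natrM exprS invfM; ring.
Qed.

(** Strictness uses up one label value per element of the chain, so [a] drops by [size s]. *)
Lemma prob_chain_ge s (a : nat) :
    nested s -> (a <= K)%N ->
  ((a - size s)%N%:R / K%:R) ^+ #|top s| / (\prod_(p <- s) #|p.2|)%:R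
  <= prob R (fun l => labels_from (top s) a l && chain_min s l).
Proof.
elim: s a => [|[x X] s IHs] a ns aK.
  rewrite big_nil cards0 expr0 divr1 probT //; first exact: card_labels_gt0.
  by move=> l; rewrite andbT; apply/forall_inP => z; rewrite inE.
rewrite prob_chain_rec // big_cons.
have := nested_card ns; move: (ns) => /and4P[_ _ _ ns'] /=.
set n := #|X|; set n' := #|top s|; set q := (\prod_(_ <- _) _)%N => n'n.
set m := size s.
have n0 : (0 < n)%N by case: n n'n.
have K0 : 0 < K%:R :> R by rewrite ltr0n.
apply: (@le_trans _ _
    (\sum_(b < a) K%:R^-1 * (((b - m)%N%:R / K%:R) ^+ n.-1 / q%:R))); last first.
  apply: ler_sum => b _; rewrite -mulrA ler_wpM2l ?invr_ge0 ?ler0n //.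
  have bK : (b <= K)%N by exact: leq_trans (ltnW (ltn_ord b)) aK.
  have -> : n.-1 = ((n - n').-1 + n')%N by lia.
  rewrite exprD -mulrA ler_pM ?IHs //.
  - by rewrite exprn_ge0 // divr_ge0 ?ler0n.
  - by rewrite !mulr_ge0 ?exprn_ge0 ?divr_ge0 ?invr_ge0 ?ler0n.
  - rewrite lerXn2r // ?nnegrE ?divr_ge0 ?ler0n //.
    by rewrite ler_wpM2r ?invr_ge0 ?ler0n // ler_nat leq_subr.
rewrite -mulr_sumr -mulr_suml natrM invfM !mulrA ler_wpM2r ?invr_ge0 ?ler0n //.
rewrite ler_pdivrMr ?ltr0n //.
have -> : \sum_(b < a) ((b - m)%N%:R / K%:R) ^+ n.-1
   = (\sum_(b < a) (b - m) ^ n.-1)%N%:R / K%:R ^+ n.-1 :> R.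
  by rewrite natr_sum mulr_suml; apply: eq_bigr => b _; rewrite expr_div_n natrX.
move: (prednK n0); move: n.-1 => p <-.
rewrite [X in _ <= X](_ : _ =
    (p.+1 * \sum_(b < a) (b - m) ^ p)%N%:R / K%:R ^+ p.+1).
  rewrite expr_div_n ler_wpM2r ?invr_ge0 ?exprn_ge0 ?ler0n //.
  by rewrite -natrX ler_nat sum_expn_ge.
by rewrite natrM exprS invfM; ring.
Qed.

End Chain.


(** * Simultaneous local minima at two or three points *)

Section Minima.
Variables (R : realFieldType) (L : finType) (K : nat).
Hypothesis K_gt0 : (0 < K)%N.
Local Notation Om := {ffun L -> 'I_K}.
Implicit Types (l : Om) (x y z : L) (X Y Z : {set L}).

Lemma prob_chain_full_le s : nested s ->
  prob R (chain_min s : pred Om) <= (\prod_(p <- s) #|p.2|)%:R^-1.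
Proof.
move=> ns; have := @prob_chain_le R L K K_gt0 s K ns (leqnn K).
rewrite divff ?pnatr_eq0 -?lt0n // expr1n mul1r; apply: le_trans.
by apply: le_prob => l ->; rewrite andbT; apply/forall_inP => z; rewrite subnn.
Qed.

Lemma prob_chain_full_ge s : nested s ->
  ((K - size s)%N%:R / K%:R) ^+ #|top s| / (\prod_(p <- s) #|p.2|)%:R
    <= prob R (chain_min s : pred Om).
Proof.
move=> ns; apply: le_trans (@prob_chain_ge R L K K_gt0 s K ns (leqnn K)) _.
by apply: le_prob => l /andP[].
Qed.

Lemma prob_min_le x X : x \in X ->
  prob R (fun l => strict_min l x X) <= #|X|%:R^-1.
Proof.
move=> xX; have := @prob_chain_full_le [:: (x, X)].
rewrite /= xX inE sub0set big_seq1 => /(_ isT); apply: le_trans.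
by apply: le_prob => l; rewrite /= andbT.
Qed.

Lemma prob_min_ge x X : x \in X ->
  ((K - 1)%N%:R / K%:R) ^+ #|X| / #|X|%:R <= prob R (fun l => strict_min l x X).
Proof.
move=> xX; have := @prob_chain_full_ge [:: (x, X)].
rewrite /= xX inE sub0set big_seq1 => /(_ isT) H; apply: le_trans H _.
by apply: le_prob => l; rewrite /= andbT.
Qed.

Lemma strict_minS l x X Y : X \subset Y -> strict_min l x Y -> strict_min l x X.
Proof. by move=> /subsetP XY /forall_inP m; apply/forall_inP => z /XY; apply: m. Qed.

Lemma strict_min_lt l x y X : strict_min l x X -> y \in X -> y != x -> (l x < l y)%N.
Proof. by move=> /forall_inP m /m /implyP. Qed.

Lemma strict_minU l x X Y : strict_min l x (X :|: Y) = strict_min l x X && strict_min l x Y.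
Proof.
apply/idP/andP => [m|[/forall_inP mX /forall_inP mY]].
  by split; apply: strict_minS m; rewrite ?subsetUl ?subsetUr.
by apply/forall_inP => z /setUP[/mX|/mY].
Qed.

Lemma strict_min_ext l x y X Y :
    strict_min l x X -> strict_min l y Y -> (l x < l y)%N ->
  strict_min l x (X :|: Y).
Proof.
move=> mX mY xy; rewrite strict_minU mX /=; apply/forall_inP => z zY.
apply/implyP => _; case: (eqVneq z y) => [->//|zy].
exact: ltn_trans xy (strict_min_lt mY zY zy).
Qed.

(** Each order of the two labels is a chain: the smaller one is the minimum of the union. The two
    chains are incompatible, each placing one label strictly below the other, so their probabilities
    add. *)
Lemma prob_min2_ge x y X Y (N : nat) :
    x \in X -> y \in Y -> x \notin Y -> y \notin X -> #|X| = N -> #|Y| = N ->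
  2 * (((K - 2)%N%:R / K%:R) ^+ #|X :|: Y| / (N%:R * #|X :|: Y|%:R))
    <= prob R (fun l => strict_min l x X && strict_min l y Y).
Proof.
move=> xX yY xY yX XN YN.
pose s1 := [:: (x, X :|: Y); (y, Y)]; pose s2 := [:: (y, X :|: Y); (x, X)].
have n1 : nested s1 by rewrite /= !inE xX xY yY subsetUr sub0set.
have n2 : nested s2 by rewrite /= !inE yY yX xX subsetUl sub0set orbT.
have := prob_chain_full_ge n1; have := prob_chain_full_ge n2.
rewrite /s1 /s2 !big_cons !big_nil !muln1 /= XN YN !natrM ![_ * N%:R]mulrC => p2 p1.
rewrite mulr_natl mulr2n. apply: le_trans (lerD p1 p2) _.
rewrite /prob -expectD; apply: le_expect => l.
rewrite /= !andbT !strict_minU.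
have yx : y != x by apply: contraNneq xY => <-.
case: (boolP (strict_min l x X)) => mxX; rewrite /= ?andbF ?addr0 //.
case: (boolP (strict_min l y Y)) => myY; rewrite /= ?andbF ?addr0 //.
rewrite !andbT; case: (boolP (strict_min l x Y)) => mxY; last first.
  by rewrite add0r lern1; case: (strict_min l y X).
case: (boolP (strict_min l y X)) => myX; rewrite ?addr0 //.
have := ltn_trans (strict_min_lt mxY yY yx) (strict_min_lt myX xX _).
by rewrite ltnn eq_sym => /(_ yx).
Qed.

Lemma prob_tie_le x y : x != y -> prob R (fun l => l x == l y) <= K%:R^-1.
Proof.
move=> xy.
have p1 z v : prob R (fun l => l z == v) = K%:R^-1.
  have := @prob_labels_from R L K K_gt0 z set0 K v (leqnn K).
  rewrite inE cards0 expr0 mulr1 => <- //; apply: eq_prob => l.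
  rewrite (_ : labels_from _ _ _) ?andbT //.
  by apply/forall_inP => w; rewrite inE.
have -> : prob R (fun l => l x == l y)
    = \sum_(v : 'I_K) prob R (fun l => (l x == v) && (l y == v)).
  rewrite /prob -expect_sum; apply: eq_expect => l.
  rewrite (bigD1 (l x)) //= eqxx [l y == _]eq_sym big1 ?addr0 // => v vx.
  by rewrite eq_sym (negPf vx).
rewrite (eq_bigr (fun=> K%:R^-1 * K%:R^-1)) => [|v _].
  rewrite sumr_const card_ord -[X in X <= _]mulr_natl mulrA divff ?mul1r //.
  by rewrite pnatr_eq0 -lt0n.
rewrite (@probM_indep R L K K_gt0 [set x] [set y]) ?p1 //.
- by move=> l1 l2 e; rewrite e // inE.
- by move=> l1 l2 e; rewrite e // inE.
- by rewrite disjoints1 inE; exact: xy.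
Qed.

(** The size of the triple union is weakened to that of [Y :|: Z]: the bound then depends on one
    pair only and can be summed over the third edge. *)
Lemma prob_min3_chain x y z X Y Z (N : nat) :
    x \in X -> y \in Y -> z \in Z -> x \notin Y -> x \notin Z -> y \notin Z ->
    #|Z| = N ->
  prob R (fun l => [&& strict_min l x X, strict_min l y Y, strict_min l z Z,
                       (l x < l y)%N & (l y < l z)%N])
    <= (N%:R * #|Y :|: Z|%:R ^+ 2)^-1.
Proof.
move=> xX yY zZ xY xZ yZ ZN.
pose s := [:: (x, X :|: (Y :|: Z)); (y, Y :|: Z); (z, Z)].
have ns : nested s.
  by rewrite /= !inE xX yY zZ (negPf xY) (negPf xZ) yZ /= !subsetUr sub0set.
have := prob_chain_full_le ns; rewrite /s !big_cons big_nil muln1 /= ZN => p.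
apply: le_trans (_ : prob R (chain_min s : pred Om) <= _).
  apply: le_prob => l /and5P[mx my mz xy yz] /=.
  rewrite mz (strict_min_ext my mz yz) /= andbT.
  have myz := strict_min_ext my mz yz.
  exact: (strict_min_ext mx myz xy).
apply: le_trans p _.
have N0 : (0 < N)%N by rewrite -ZN; apply/card_gt0P; exists z.
have U0 : (0 < #|Y :|: Z|)%N by apply/card_gt0P; exists y; rewrite inE yY.
have U3 : (#|Y :|: Z| <= #|X :|: (Y :|: Z)|)%N by rewrite subset_leq_card ?subsetUr.
have pos : (0 < N * (#|Y :|: Z| * #|Y :|: Z|))%N by rewrite !muln_gt0 N0 U0.
rewrite lef_pV2 ?posrE; last 2 first.
- by rewrite ltr0n !muln_gt0 (leq_trans U0 U3) U0 N0.
- by rewrite mulr_gt0 ?exprn_gt0 ?ltr0n.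
rewrite expr2 -!natrM ler_nat (_ : (N * _ = #|Y :|: Z| * (#|Y :|: Z| * N))%N).
  exact: leq_mul.
by rewrite mulnC -mulnA.
Qed.

(** There are two orders for each choice of the smallest label, each bounded through the union
    belonging to the two larger ones, and three possible ties. *)
Lemma prob_min3_le x y z X Y Z (N : nat) :
    x \in X -> y \in Y -> z \in Z ->
    x \notin Y -> x \notin Z -> y \notin X -> y \notin Z -> z \notin X -> z \notin Y ->
    #|X| = N -> #|Y| = N -> #|Z| = N ->
  prob R (fun l => [&& strict_min l x X, strict_min l y Y & strict_min l z Z])
    <= 2 / N%:R * ((#|X :|: Y|%:R ^+ 2)^-1 + (#|X :|: Z|%:R ^+ 2)^-1
                   + (#|Y :|: Z|%:R ^+ 2)^-1) + 3 / K%:R.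
Proof.
move=> xX yY zZ xY xZ yX yZ zX zY XN YN ZN.
have xy : x != y by apply: contraNneq xY => ->.
have xz : x != z by apply: contraNneq xZ => ->.
have yz : y != z by apply: contraNneq yZ => ->.
have tie1 := prob_tie_le xy; have tie2 := prob_tie_le xz.
have tie3 := prob_tie_le yz.
have c1 := prob_min3_chain xX yY zZ xY xZ yZ ZN.
have c2 := prob_min3_chain xX zZ yY xZ xY zY YN.
have c3 := prob_min3_chain yY xX zZ yX yZ xZ ZN.
have c4 := prob_min3_chain yY zZ xX yZ yX zX XN.
have c5 := prob_min3_chain zZ xX yY zX zY xY YN.
have c6 := prob_min3_chain zZ yY xX zY zX yX XN.
rewrite [Y :|: X]setUC in c6 *; rewrite [Z :|: X]setUC in c4; rewrite [Z :|: Y]setUC in c2.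
rewrite (invfM N%:R) in c1 c2; rewrite (invfM N%:R) in c3 c4; rewrite (invfM N%:R) in c5 c6.
set p := prob _ _; set a := (#|X :|: Y|%:R ^+ 2)^-1 in c5 c6 *.
set b := (#|X :|: Z|%:R ^+ 2)^-1 in c3 c4 *; set c := (#|Y :|: Z|%:R ^+ 2)^-1 in c1 c2 *.
apply: (@le_trans _ _ (
  (N%:R^-1 * c + N%:R^-1 * c) + (N%:R^-1 * b + N%:R^-1 * b)
  + (N%:R^-1 * a + N%:R^-1 * a) + (K%:R^-1 + K%:R^-1 + K%:R^-1))); last first.
  by rewrite le_eqVlt; apply/orP; left; apply/eqP; ring.
have := lerD (lerD (lerD (lerD c1 c2) (lerD c3 c4)) (lerD c5 c6))
  (lerD (lerD tie1 tie2) tie3).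
apply: le_trans.
rewrite /p /prob -!expectD; apply: le_expect => l.
case mX: (strict_min l x X) => //=; last by rewrite !addr_ge0 ?ler0n.
case mY: (strict_min l y Y) => //=; last by rewrite !addr_ge0 ?ler0n.
case mZ: (strict_min l z Z) => //=; last by rewrite !addr_ge0 ?ler0n.
rewrite -!natrD ler1n.
rewrite -![l _ == l _](inj_eq val_inj) /=.
by case: (ltngtP (l x) (l y)); case: (ltngtP (l x) (l z)); case: (ltngtP (l y) (l z)) => //=; lia.
Qed.

End Minima.

(** * The neighbourhood of an edge *)


Section Calculus.
Variable R : realFieldType.
Implicit Types D b r s x w m d y : R.

(** Here [b] is the number of edges of [N[e]] disjoint from [f], and [x1], [x2] are counts at the
    two vertices of [f] outside [e]. With [s = (D - x1) + (D - x2)], the value [s (4D - s)] exceeds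
    the split sum by [(x1 - x2)^2], so the bound separates over the two vertices. The slope, at most
    [4D], turns [b >= s - y] into the loss [4Dy]. *)
Lemma concave_split D b x1 x2 y :
    0 <= D -> 0 <= y -> 0 <= b <= 2 * D -> 0 <= x1 <= D -> 0 <= x2 <= D ->
    3 * D - y <= b + D + (x1 + x2) ->
  2 * (D ^+ 2 - x1 ^+ 2) + 2 * (D ^+ 2 - x2 ^+ 2) - 4 * D * y <= b * (4 * D - b).
Proof.
move=> D0 y0 /andP[b0 b2] /andP[x10 x1D] /andP[x20 x2D] h.
pose s := 2 * D - x1 - x2.
have sD : s <= 2 * D by rewrite /s; lra.
have s0 : 0 <= s by rewrite /s; lra.
have split : 2 * (D ^+ 2 - x1 ^+ 2) + 2 * (D ^+ 2 - x2 ^+ 2) <= s * (4 * D - s).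
  rewrite -subr_ge0 [X in 0 <= X](_ : _ = (x1 - x2) ^+ 2) ?sqr_ge0 //.
  by rewrite /s; ring.
suff : s * (4 * D - s) - 4 * D * y <= b * (4 * D - b) by lra.
have bs : s - b <= y by rewrite /s; lra.
have -> : b * (4 * D - b) = s * (4 * D - s) - (s - b) * (4 * D - s - b) by ring.
rewrite lerD2l lerN2 mulrC.
have [sb|bs0] := lerP s b.
  apply: (@le_trans _ _ 0); last by rewrite !mulr_ge0.
  by rewrite mulr_ge0_le0 //; lra.
by apply: ler_pM => //; lra.
Qed.

Lemma shift_square D x w s :
    0 <= x <= D -> 0 <= w <= D -> 0 <= s -> x <= w + s ->
  2 * (D ^+ 2 - w ^+ 2) - 4 * D * s <= 2 * (D ^+ 2 - x ^+ 2).
Proof.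
move=> /andP[x0 xD] /andP[w0 wD] s0 h.
have -> : 2 * (D ^+ 2 - x ^+ 2) = 2 * (D ^+ 2 - w ^+ 2) - 2 * ((x - w) * (x + w)) by ring.
rewrite lerD2l lerN2; have [xw|wx] := lerP x w.
  apply: (@le_trans _ _ 0); last by rewrite !mulr_ge0 //; lra.
  by rewrite pmulr_rle0 // mulr_le0_ge0 //; lra.
have : (x - w) * (x + w) <= s * (2 * D) by apply: ler_pM; lra.
lra.
Qed.

(** Equality at [m = d / 3]: the edges at an outer vertex split evenly among the three vertices of
    [e]. *)
Lemma amgm_cubic d m : 0 <= m <= d -> m * (d - m) ^+ 2 <= 4 / 27 * d ^+ 3.
Proof.
move=> /andP[m0 md]; rewrite -subr_ge0.
rewrite [X in 0 <= X](_ : _ = (m - d / 3) ^+ 2 * (4 * d / 3 - m)); last by field.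
by rewrite mulr_ge0 ?sqr_ge0 //; lra.
Qed.

End Calculus.

Section Neighbourhood.
Variables (R : realFieldType) (V E : finType) (ends : E -> {set V}).
Variables (S : {set E}) (D : nat).
Hypothesis card_ends : forall e, #|ends e| = 3%N.
Hypothesis degS : forall v, (#|[set f in S | v \in ends f]| <= D)%N.

Definition disj (f g : E) := [disjoint ends f & ends g].

Definition nb (e : E) := [set f in S | ~~ disj e f].

Lemma disj_sym f g : disj f g = disj g f.
Proof. exact: disjoint_sym. Qed.

Lemma disj_irr e : disj e e = false.
Proof.
rewrite /disj -setI_eq0 setIid; apply/negbTE.
by rewrite -card_gt0 card_ends.
Qed.

Lemma mem_nb_sym e f : e \in S -> f \in S -> (f \in nb e) = (e \in nb f).
Proof. by move=> eS fS; rewrite !inE eS fS disj_sym. Qed.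

Lemma mem_nb e : e \in S -> e \in nb e.
Proof. by move=> eS; rewrite inE eS disj_irr. Qed.

Lemma disjPn f g : reflect (exists2 v, v \in ends f & v \in ends g) (~~ disj f g).
Proof.
rewrite /disj -setI_eq0; apply: (iffP (set0Pn _)) => [[v]|[v vf vg]].
  by rewrite inE => /andP[]; exists v.
by exists v; rewrite inE vf.
Qed.

Lemma mem_sep (B : {set E}) (P : pred E) g :
  (g \in [set h in B | P h]) = (g \in B) && P g.
Proof. by rewrite inE. Qed.

Lemma card_sep (B : {set E}) (P : pred E) :
  #|[set h in B | P h]| = (\sum_(h in B) P h)%N.
Proof.
rewrite -sum1_card big_mkcond [RHS]big_mkcond; apply: eq_bigr => g _.
by rewrite mem_sep; case: (g \in B); case: (P g).
Qed.

Section At.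
Variable e : E.
Local Notation A := (nb e).
Local Notation a := #|nb e|.

Definition beta f := #|[set g in A | disj f g]|.
Definition common_disj f g := #|[set h in A | disj f h && disj g h]|.

Lemma card_inter f : #|ends f :&: ends e| = (\sum_(v in ends e) (v \in ends f))%N.
Proof.
rewrite -sum1_card big_mkcond [RHS]big_mkcond; apply: eq_bigr => v _.
by rewrite inE; case: (v \in ends f); case: (v \in ends e).
Qed.

Lemma nb_sub : A \subset S.
Proof. by apply/subsetP => f; rewrite inE => /andP[]. Qed.

Lemma deg_sub (B : {set E}) v :
  B \subset S -> (#|[set f in B | v \in ends f]| <= D)%N.
Proof.
move=> /subsetP BS; apply: leq_trans (degS v); apply/subset_leq_card/subsetP => f.
by rewrite !inE => /andP[/BS -> ->].
Qed.

Lemma sum_inter_le : (\sum_(f in A) #|ends f :&: ends e| <= 3 * D)%N.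
Proof.
under eq_bigr => f _ do rewrite card_inter.
rewrite exchange_big /= -(card_ends e) -sum_nat_const; apply: leq_sum => v ve.
by rewrite -card_sep deg_sub // nb_sub.
Qed.

Lemma inter_gt0 f : f \in A -> (0 < #|ends f :&: ends e|)%N.
Proof.
rewrite inE disj_sym => /andP[_ /disjPn[v vf ve]].
by apply/card_gt0P; exists v; rewrite inE vf.
Qed.

Lemma card_nb_le : (a <= 3 * D)%N.
Proof.
apply: leq_trans sum_inter_le; rewrite -sum1_card; apply: leq_sum => f.
exact: inter_gt0.
Qed.

Lemma card_through (X : {set V}) (B : {set E}) :
    B \subset S -> (forall f, f \in B -> exists2 v, v \in X & v \in ends f) ->
  (#|B| <= #|X| * D)%N.
Proof.
move=> BS BX; rewrite -sum1_card.
apply: (@leq_trans (\sum_(f in B) \sum_(v in X) (v \in ends f))%N).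
  apply: leq_sum => f fB; have [v vX vf] := BX f fB.
  by rewrite (bigD1 v) //= vf.
rewrite exchange_big /= -sum_nat_const; apply: leq_sum => v vX.
by rewrite -card_sep deg_sub.
Qed.

(** Edges of [nb e] disjoint from [f] pass through one of the at most two vertices of [e] missed by
    [f]. *)
Lemma beta_le f : f \in A -> (beta f <= 2 * D)%N.
Proof.
move=> fA; apply: (@leq_trans (#|ends e :\: ends f| * D)).
  apply: card_through => [|g].
    by apply: subset_trans nb_sub; apply/subsetP => g; rewrite inE => /andP[].
  rewrite !inE => /andP[/andP[_ /disjPn[v ve vg]] fg]; exists v => //.
  rewrite inE ve andbT; apply: contraTN fg => vf; apply/disjPn; by exists v.
rewrite leq_mul2r cardsD card_ends; have := inter_gt0 fA; rewrite setIC; lia.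
Qed.

(** Disjoint [f] and [g] occupy different vertices of [e], so at most one vertex of [e] is left for
    the edges disjoint from both. *)
Lemma common_disj_le f g :
  f \in A -> g \in A -> disj f g -> (common_disj f g <= D)%N.
Proof.
move=> fA gA fg; rewrite -[leqRHS]mul1n.
apply: (@leq_trans (#|ends e :\: (ends f :|: ends g)| * D)).
  apply: card_through => [|h].
    by apply: subset_trans nb_sub; apply/subsetP => h; rewrite inE => /andP[].
  rewrite !inE => /and3P[/andP[_ /disjPn[v ve vh]] fh gh]; exists v => //.
  rewrite !inE ve andbT negb_or; apply/andP; split.
    by apply: contraTN fh => vf; apply/disjPn; exists v.
  by apply: contraTN gh => vg; apply/disjPn; exists v.
rewrite leq_mul2r cardsD card_ends setIUr cardsU.
rewrite (_ : _ :&: _ :&: _ = set0) ?cards0; last first.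
  apply/setP => v; rewrite !inE; apply/negP => /andP[/andP[_ vf] /andP[_ vg]].
  by move: fg; apply/negP/disjPn; exists v.
have := inter_gt0 fA; have := inter_gt0 gA; rewrite ![_ :&: ends e]setIC; lia.
Qed.

Lemma common_disj_beta_l f g : (common_disj f g <= beta f)%N.
Proof.
by apply/subset_leq_card/subsetP => h; rewrite !inE => /and3P[-> ->].
Qed.

Lemma common_disj_beta_r f g : (common_disj f g <= beta g)%N.
Proof.
by apply/subset_leq_card/subsetP => h; rewrite !inE => /and3P[-> _ ->].
Qed.

(** Inclusion-exclusion inside [nb e]: an edge there that is disjoint from neither [f] nor [g] is a
    common neighbour. *)
Lemma common_nb_ge f g :
  f \in S -> g \in S ->
  (a + common_disj f g <= #|nb f :&: nb g| + beta f + beta g)%N.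
Proof.
move=> fS gS; pose Bf := [set h in A | disj f h]; pose Bg := [set h in A | disj g h].
have -> : common_disj f g = #|Bf :&: Bg|.
  apply: eq_card => h; rewrite /Bf /Bg !inE.
  by case: (h \in S); case: (disj e h); case: (disj f h).
have := cardsUI Bf Bg; rewrite -/(beta f) -/(beta g) => UI.
suff : (a <= #|nb f :&: nb g| + #|Bf :|: Bg|)%N by lia.
rewrite -(cardsID (Bf :|: Bg) A) addnC leq_add //; last first.
  by apply/subset_leq_card/subsetP => h; rewrite inE => /andP[].
apply/subset_leq_card/subsetP => h; rewrite /Bf /Bg !inE.
by case: (h \in S); case: (disj e h); case: (disj f h); case: (disj g h).
Qed.

Definition singles := [set f in A | #|ends f :&: ends e| == 1%N].
Local Notation A1 := singles.

(* An edge [f] of [nb e] meeting [e] in [v] alone is disjoint from all edges of [nb e]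
   but those through [v] and those counted by [avoiding v z] for the two other
   vertices [z] of [f]. *)
Definition avoiding v z := #|[set h in A | (z \in ends h) && (v \notin ends h)]|.
Definition joint v z := #|[set h in A1 | (v \in ends h) && (z \in ends h)]|.
Definition single_deg z := #|[set h in A1 | z \in ends h]|.
Definition multi_deg z := #|[set h in A :\: A1 | z \in ends h]|.

Lemma singles_sub : A1 \subset A.
Proof. by apply/subsetP => f; rewrite inE => /andP[]. Qed.

Lemma card_outside f : #|ends f :\: ends e| = (3 - #|ends f :&: ends e|)%N.
Proof. by rewrite cardsD card_ends. Qed.

Lemma beta_single f v : f \in A1 -> v \in ends f -> v \in ends e ->
  (a <= beta f + D + \sum_(z in ends f :\: ends e) avoiding v z)%N.
Proof.
move=> fA1 vf ve.
under eq_bigr => z _ do rewrite /avoiding card_sep.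
rewrite exchange_big /=.
apply: (@leq_trans (beta f + \sum_(g in A) (v \in ends g)
   + \sum_(g in A) \sum_(z in ends f :\: ends e)
      ((z \in ends g) && (v \notin ends g)))%N); last first.
  by rewrite leq_add2r leq_add2l -card_sep deg_sub // nb_sub.
rewrite /beta card_sep -!big_split /= -sum1_card; apply: leq_sum => g gA.
case: (boolP (disj f g)) => // /disjPn[w wf wg].
case: (boolP (v \in ends g)) => // vg; rewrite !add0n.
have [we|we] := boolP (w \in ends e); last first.
  by rewrite (bigD1 w) ?inE ?we ?wf //= wg.
move: fA1; rewrite mem_sep => /andP[_ /cards1P[u fe]].
have : v \in ends f :&: ends e by rewrite inE vf.
have : w \in ends f :&: ends e by rewrite inE wf.
by rewrite fe !inE => /eqP wu /eqP vu; rewrite vu -wu wg in vg.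
Qed.

Lemma sum_single_deg : (\sum_(z in ~: ends e) single_deg z = 2 * #|A1|)%N.
Proof.
under eq_bigr => z _ do rewrite /single_deg card_sep.
rewrite exchange_big /= mulnC -sum_nat_const; apply: eq_bigr => f.
rewrite mem_sep => /andP[_ /eqP f1].
transitivity #|ends f :\: ends e|; last by rewrite card_outside f1.
rewrite -sum1_card.
rewrite big_mkcond [RHS]big_mkcond; apply: eq_bigr => z _.
by rewrite !inE; case: (z \in ends e); case: (z \in ends f).
Qed.

(** An edge meeting [e] in [i >= 2] vertices takes [i] of the at most [3D] incidences with [e], and
    [1 + (3 - i) <= i] pays for the edge and for its outer ends. So those outer ends number at most
    [y]. *)
Lemma sum_multi_deg : (\sum_(z in ~: ends e) multi_deg z + a <= 3 * D)%N.
Proof.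
apply: leq_trans sum_inter_le.
under eq_bigr => z _ do rewrite /multi_deg card_sep.
rewrite exchange_big /= [leqRHS](big_setID A1) /= (setIidPr singles_sub) addnC.
rewrite -(cardsID A1 A) (setIidPr singles_sub) -addnA leq_add //.
  rewrite -sum1_card; apply: leq_sum => f; rewrite mem_sep => /andP[fA _].
  exact: inter_gt0.
rewrite -sum1_card -big_split /=; apply: leq_sum => f.
rewrite inE => /andP[nf1 fA].
have -> : (\sum_(z in ~: ends e) (z \in ends f) = #|ends f :\: ends e|)%N.
  rewrite -sum1_card big_mkcond [RHS]big_mkcond; apply: eq_bigr => z _.
  by rewrite !inE; case: (z \in ends e); case: (z \in ends f).
rewrite card_outside; have := inter_gt0 fA; move: nf1; rewrite mem_sep fA /=.
by move=> /eqP; lia.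
Qed.

Lemma card_singles_ge : (2 * a <= 3 * D + #|A1|)%N.
Proof.
apply: leq_trans (leq_add sum_inter_le (leqnn _)).
rewrite mulnC -sum_nat_const /singles card_sep -big_split /=.
apply: leq_sum => f /inter_gt0; case: eqP; lia.
Qed.

Lemma single_multi_deg z : (single_deg z + multi_deg z)%N = #|[set h in A | z \in ends h]|.
Proof.
rewrite /single_deg /multi_deg !card_sep [RHS](big_setID A1) /=.
by rewrite (setIidPr singles_sub).
Qed.

Lemma avoiding_le v z : (avoiding v z + joint v z <= single_deg z + multi_deg z)%N.
Proof.
rewrite single_multi_deg /avoiding /joint -cardsUI.
rewrite [X in (_ + X)%N](_ : _ = 0%N) ?addn0.
  apply/subset_leq_card/subsetP => h; rewrite in_setU !mem_sep.
  case/orP => [/and3P[-> ->] //|/and3P[h1 _ ->]].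
  by case/andP: h1 => ->.
apply/eqP; rewrite cards_eq0; apply/eqP/setP => h; rewrite in_setI !mem_sep inE.
by case: (v \in ends h); rewrite ?andbF.
Qed.

Lemma avoiding_leD v z : (avoiding v z <= D)%N.
Proof.
apply: leq_trans (deg_sub z nb_sub); apply/subset_leq_card/subsetP => h.
by rewrite !mem_sep => /and3P[-> ->].
Qed.

Lemma sum_joint z : (\sum_(v in ends e) joint v z = single_deg z)%N.
Proof.
under eq_bigr => v _ do rewrite /joint card_sep.
rewrite exchange_big /= /single_deg card_sep; apply: eq_bigr => f.
rewrite mem_sep => /andP[_ /eqP f1]; case: (z \in ends f); last first.
  by rewrite big1 // => v _; rewrite andbF.
rewrite -[RHS]f1 card_inter; apply: eq_bigr => v _; by rewrite andbT.
Qed.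

Lemma single_multi_leD z : (single_deg z + multi_deg z <= D)%N.
Proof. by rewrite single_multi_deg deg_sub // nb_sub. Qed.

Definition nonadjacency_sum : R := \sum_(f in A) (beta f)%:R * (4 * D%:R - (beta f)%:R).

Lemma single_beta_bound f (y : R) : f \in A1 -> y = 3 * D%:R - a%:R ->
  \sum_(v in ends e | v \in ends f) \sum_(z in ~: ends e | z \in ends f)
     2 * (D%:R ^+ 2 - (avoiding v z)%:R ^+ 2) - 4 * D%:R * y
  <= (beta f)%:R * (4 * D%:R - (beta f)%:R).
Proof.
move=> fA1 yE; have := fA1; rewrite mem_sep => /andP[fA f1].
have [v fe] := cards1P f1.
have [z1 [z2 z12 fo]] : exists z1, exists2 z2, z1 != z2 & ends f :\: ends e = [set z1; z2].
  have : #|ends f :\: ends e| == 2%N by rewrite card_outside (eqP f1).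
  by move=> /cards2P[z1 [z2 [n12 ->]]]; exists z1; exists z2.
have vfe : v \in ends f :&: ends e by rewrite fe inE.
move: (vfe); rewrite inE => /andP[vf ve].
rewrite (big_pred1 v) => [|u]; last first.
  by move/setP/(_ u): (fe); rewrite !inE andbC.
rewrite (eq_bigl (mem [set z1; z2])) => [|u]; last by rewrite -fo !inE.
rewrite big_setU1 ?inE //= big_set1.
have := beta_single fA1 vf ve; rewrite fo big_setU1 ?inE //= big_set1 => h.
apply: concave_split; rewrite ?ler0n //=.
- by rewrite yE subr_ge0 -natrM ler_nat card_nb_le.
- by rewrite -natrM ler_nat beta_le.
- by rewrite ler_nat avoiding_leD.
- by rewrite ler_nat avoiding_leD.
- by rewrite yE opprB addrCA subrr addr0 -!natrD ler_nat.
Qed.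

(** With [m = joint v z], at most [d - m + s] edges through [z] avoid [v], and the three values of
    [m] sum to [d]. Bounding [m (d - m)^2] three times and using [d <= D] gives the coefficient
    [2 (1 - 3 * 4 / 27) = 10 / 9]. *)
Lemma vertex_bound z (d s : R) : d = (single_deg z)%:R -> s = (multi_deg z)%:R ->
  10 / 9 * D%:R ^+ 2 * d - 4 * D%:R ^+ 2 * s <=
  \sum_(v in ends e) (joint v z)%:R * (2 * (D%:R ^+ 2 - (avoiding v z)%:R ^+ 2)).
Proof.
move=> dE sE.
have D0 : 0 <= D%:R :> R by rewrite ler0n.
have d0 : 0 <= d by rewrite dE ler0n.
have s0 : 0 <= s by rewrite sE ler0n.
have dsD : d + s <= D%:R by rewrite dE sE -natrD ler_nat single_multi_leD.
have dsum : d = \sum_(v in ends e) (joint v z)%:R by rewrite dE -sum_joint natr_sum.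
have jd v : v \in ends e -> (joint v z)%:R <= d.
  by move=> ve; rewrite dE -sum_joint ler_nat (bigD1 v) //= leq_addr.
apply: (@le_trans _ _ (\sum_(v in ends e)
   (2 * D%:R ^+ 2 * (joint v z)%:R - 2 * (4 / 27 * d ^+ 3)
     - 4 * D%:R * s * (joint v z)%:R))).
  rewrite !sumrB -!mulr_sumr -dsum sumr_const card_ends -mulr_natr.
  have d3 : d ^+ 3 <= D%:R ^+ 2 * d by rewrite exprSr ler_wpM2r // lerXn2r // ?nnegrE; lra.
  have sd : s * d <= s * D%:R by rewrite ler_wpM2l //; lra.
  have sdD : D%:R * (s * d) <= D%:R * (s * D%:R) by rewrite ler_wpM2l.
  rewrite !expr2 in d3 *.
  nra.
apply: ler_sum => v ve; set m : R := (joint v z)%:R.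
have m0 : 0 <= m by rewrite ler0n.
have md := jd v ve; rewrite -/m in md.
apply: (@le_trans _ _ (m * (2 * (D%:R ^+ 2 - (d - m) ^+ 2) - 4 * D%:R * s))).
  have := @amgm_cubic R d m; rewrite m0 md => /(_ isT); lra.
rewrite ler_wpM2l //; apply: shift_square; rewrite ?ler0n ?ler_nat ?avoiding_leD //.
  by apply/andP; split; lra.
by rewrite addrAC lerBrDr dE sE -!natrD ler_nat avoiding_le.
Qed.

(** The single degrees sum to [2 |A1| >= 6D - 4y], and [6 * 10 / 9 = 20 / 3]. The coefficient of [y]
    is [40 / 9] for missing single edges, [4] for multiple incidences at outer vertices, and [12]
    for the loss [4Dy] on each of at most [3D] single edges. *)
Lemma nonadjacency_sum_ge (y : R) : y = 3 * D%:R - a%:R ->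
  20 / 3 * D%:R ^+ 3 - 184 / 9 * D%:R ^+ 2 * y <= nonadjacency_sum.
Proof.
move=> yE.
have D0 : 0 <= D%:R :> R by rewrite ler0n.
have y0 : 0 <= y by rewrite yE subr_ge0 -natrM ler_nat card_nb_le.
pose H v z : R := 2 * (D%:R ^+ 2 - (avoiding v z)%:R ^+ 2).
apply: (@le_trans _ _ (\sum_(f in A1) (beta f)%:R * (4 * D%:R - (beta f)%:R))); last first.
  rewrite /nonadjacency_sum [leRHS](big_setID A1) /= (setIidPr singles_sub) lerDl.
  apply: sumr_ge0 => f; rewrite inE => /andP[_ /beta_le]; rewrite -(ler_nat R) natrM.
  by move=> ?; rewrite mulr_ge0 ?ler0n //; lra.
apply: (@le_trans _ _ (\sum_(f in A1)
   (\sum_(v in ends e | v \in ends f) \sum_(z in ~: ends e | z \in ends f)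
     H v z - 4 * D%:R * y))); last first.
  by apply: ler_sum => f fA1; apply: single_beta_bound.
rewrite sumrB sumr_const -[X in _ <= _ - X]mulr_natr.
have -> : \sum_(f in A1) \sum_(v in ends e | v \in ends f)
    \sum_(z in ~: ends e | z \in ends f) H v z
  = \sum_(z in ~: ends e) \sum_(v in ends e) (joint v z)%:R * H v z.
  rewrite [RHS]exchange_big /=.
  under eq_bigr => f _ do rewrite big_mkcondr /=.
  rewrite exchange_big /=; apply: eq_bigr => v _.
  transitivity (\sum_(f in A1) \sum_(z in ~: ends e)
     ((v \in ends f) && (z \in ends f))%:R * H v z).
    apply: eq_bigr => f _; case: (v \in ends f); last first.
      by rewrite big1 // => z _; rewrite mul0r.
    rewrite big_mkcondr /=; apply: eq_bigr => z _.
    by case: (z \in ends f); rewrite ?mul1r ?mul0r.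
  rewrite exchange_big /=; apply: eq_bigr => z _.
  by rewrite -mulr_suml /joint card_sep natr_sum.
have vb : \sum_(z in ~: ends e) (10 / 9 * D%:R ^+ 2 * (single_deg z)%:R
     - 4 * D%:R ^+ 2 * (multi_deg z)%:R)
   <= \sum_(z in ~: ends e) \sum_(v in ends e) (joint v z)%:R * H v z :> R.
  by apply: ler_sum => z _; apply: vertex_bound.
rewrite sumrB -!mulr_sumr -!natr_sum sum_single_deg natrM in vb.
have := sum_multi_deg; rewrite -(ler_nat R) natrD natrM.
set M : R := (\sum_(_ in _) _)%N%:R in vb * => Mle.
have := card_singles_ge; rewrite -(ler_nat R) natrD !natrM => sge.
have sle : #|A1|%:R <= 3 * D%:R :> R.
  by rewrite -natrM ler_nat (leq_trans (subset_leq_card singles_sub)) ?card_nb_le.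
set n : R := #|A1|%:R in vb sge sle *.
have D20 : 0 <= D%:R ^+ 2 :> R by rewrite exprn_ge0.
have h1 : D%:R ^+ 2 * M <= D%:R ^+ 2 * y by rewrite ler_wpM2l //; lra.
have h2 : D%:R ^+ 2 * (3 * D%:R - 2 * y) <= D%:R ^+ 2 * n by rewrite ler_wpM2l //; lra.
have h3 : D%:R * y * n <= D%:R * y * (3 * D%:R) by rewrite ler_wpM2l // mulr_ge0.
rewrite exprS.
lra.
Qed.

End At.
End Neighbourhood.

(** * A local random matching *)


(* The left side is the tangent of [15 / (16 W)] at [W = 17 / 3 * D], where
   [W = 10 / 3 * D + bf + bg]; it is chosen so that, summed over all pairs, it gives
   the terms [b * (4 * D - b)], which increase with [b <= 2 * D]. *)
Lemma pair_gain (R : realFieldType) (D U t bf bg : R) :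
    0 < D -> 3 * D <= U -> U <= 10 / 3 * D + bf + bg - t ->
    0 <= t <= D -> t <= bf -> t <= bg ->
  135 / 4624 * (8 * D - bf - bg) / D ^+ 2 <= U^-1 * (1 - t / U).
Proof.
move=> D0 U3 UW /andP[t0 tD] tbf tbg.
pose W := 10 / 3 * D + bf + bg; pose U' := W - t.
have U0 : 0 < U by lra.
have U'U : U <= U' by rewrite /U' /W; lra.
have U'0 : 0 < U' by lra.
have W5 : 5 * t <= W by rewrite /W; lra.
have W0 : 0 < W by rewrite /W; lra.
have Wn : W != 0 by rewrite gt_eqF.
have U'n : W - t != 0 by rewrite gt_eqF.
have Dn : D != 0 by rewrite gt_eqF.
(* The map [u -> (1 - t / u) / u] decreases for [u >= 2t], so [U] may be replaced by its upper
   bound. *)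
have s1 : U'^-1 * (1 - t / U') <= U^-1 * (1 - t / U).
  rewrite -subr_ge0 [X in 0 <= X](_ : _ =
    (U' - U) * ((U - 2 * t) * (U' - 2 * t) / 2 + (U * U' - 4 * t ^+ 2) / 2) / (U ^+ 2 * U' ^+ 2)).
    apply: divr_ge0; last by rewrite mulr_ge0 ?exprn_ge0 ?ltW.
    apply: mulr_ge0; first by lra.
    apply: addr_ge0; first by rewrite divr_ge0 // mulr_ge0 //; lra.
    have : (2 * t) * (2 * t) <= U * U' by apply: ler_pM; lra.
    by rewrite expr2; lra.
  by field; rewrite !gt_eqF.
(* The right side is [(W - 2t) / (W - t)^2], decreasing in [t] and equal to [15 / (16 W)] at
   [t = W / 5]. *)
have s2 : 15 / 16 / W <= U'^-1 * (1 - t / U').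
  rewrite -subr_ge0 [X in 0 <= X](_ : _ = (W - 5 * t) * (W + 3 * t) / (16 * W * U' ^+ 2)).
    apply: divr_ge0; last by rewrite !mulr_ge0 ?exprn_ge0 ?ltW.
    by rewrite mulr_ge0 //; lra.
  by rewrite /U'; field; rewrite ?Wn ?U'n.
have s3 : 135 / 4624 * (8 * D - bf - bg) / D ^+ 2 <= 15 / 16 / W.
  rewrite -subr_ge0 [X in 0 <= X](_ : _ =
     135 / 4624 * (W - 17 / 3 * D) ^+ 2 / (W * D ^+ 2)).
    apply: divr_ge0; last by rewrite mulr_ge0 ?exprn_ge0 ?ltW.
    by apply: mulr_ge0; [lra|exact: sqr_ge0].
  move: Wn; rewrite /W => Wn; field; rewrite ?Dn /=.
  by apply: lt0r_neq0; move: W0; rewrite /W; lra.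
by apply: le_trans s3 _; apply: le_trans s2 s1.
Qed.

Lemma bernoulli (R : realFieldType) (x : R) n : 0 <= x <= 1 -> 1 - n%:R * x <= (1 - x) ^+ n.
Proof.
move=> /andP[x0 x1]; elim: n => [|n IHn]; first by rewrite mul0r subr0 expr0.
rewrite exprSr; apply: (@le_trans _ _ ((1 - n%:R * x) * (1 - x))).
  have : 0 <= n%:R * (x * x) :> R by rewrite !mulr_ge0 ?ler0n.
  rewrite -natr1; lra.
by rewrite ler_wpM2r // subr_ge0.
Qed.

Section Trial.
Variables (R : realFieldType) (V E : finType) (ends : E -> {set V}).
Variables (S : {set E}) (D : nat).
Hypothesis card_ends : forall e, #|ends e| = 3%N.
Hypothesis degS : forall v, (#|[set f in S | v \in ends f]| <= D)%N.
Local Notation N := (3 * D)%N.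
Local Notation nb := (nb ends S).
Local Notation disj := (disj ends).
(** Each edge owns a first-round label [None], a second-round label [Some None], and [N] dummies.
    They enter an abstract [L] through the injection [pt], so that many independent trials can share
    one label space. *)
Local Notation J := (option (option 'I_N)).

Variables (L : finType) (K : nat) (pt : E -> J -> L).
Hypothesis K_gt0 : (0 < K)%N.
Hypothesis pt_inj : forall e f i j, pt e i = pt f j -> e = f /\ i = j.
Local Notation Om := {ffun L -> 'I_K}.
Implicit Types (l : Om) (e f g h : E).

(* The private dummy labels pad every closed neighbourhood to size [N], so that all
   edges are local minima with the same probability, whatever their degree. *)
Definition label1 e := pt e None.
Definition label2 e := pt e (Some None).
Definition dummy e i := pt e (Some (Some i)).

Definition padded_nb f : {set L} :=
  [set label1 g | g in nb f]
    :|: [set dummy f i | i in [set i : 'I_N | (i < N - #|nb f|)%N]].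

Definition first_matching l := [set f in S | strict_min l (label1 f) (padded_nb f)].
Definition free_edges l := [set e in S | [disjoint nb e & first_matching l]].
(** No padding in this round: having few neighbours raises the chance of [e] here and offsets its
    smaller gain. *)
Definition second_matching l :=
  [set e in free_edges l | strict_min l (label2 e) [set label2 f | f in nb e :&: free_edges l]].
Definition trial_matching l := first_matching l :|: second_matching l.

Lemma label1_inj : injective label1.
Proof. by move=> e f /pt_inj[]. Qed.

Lemma label2_inj : injective label2.
Proof. by move=> e f /pt_inj[]. Qed.

Lemma label1_padded f g : (label1 g \in padded_nb f) = (g \in nb f).
Proof.
rewrite inE mem_imset; last exact: label1_inj.
case: (g \in nb f) => //=; apply/negbTE/imsetP => -[i _ /pt_inj[_]]; by [].
Qed.

Lemma card_padded f : #|padded_nb f| = N.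
Proof.
rewrite /padded_nb cardsU (_ : _ :&: _ = set0); last first.
  apply/setP => z; rewrite !inE; apply/negP => /andP[/imsetP[g _ ->] /imsetP[i _]].
  by case/pt_inj.
rewrite cards0 subn0 !card_imset; last 2 first.
- by move=> i j /pt_inj[_ []].
- exact: label1_inj.
have aN := card_nb_le card_ends degS f.
rewrite -[X in (_ + X)%N]sum1_card (eq_bigl (fun i : 'I_N => (i < N - #|nb f|)%N)); last first.
  by move=> i; rewrite inE.
by rewrite (big_ord_narrow (leq_subr #|nb f| N)) sum1_card card_ord subnKC.
Qed.


(** Dummies are private, so two padded neighbourhoods share exactly the labels of the common
    neighbours. *)
Lemma card_paddedU f g : f != g ->
  (#|padded_nb f :|: padded_nb g| + #|nb f :&: nb g| = 2 * N)%N.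
Proof.
move=> fg; rewrite mul2n -addnn -{1}(card_padded f) -(card_padded g) -cardsUI.
congr (_ + _)%N; rewrite -(card_imset _ label1_inj); apply: eq_card => z.
apply/imsetP/idP => [[h]|].
  by rewrite inE => /andP[hf hg] ->; rewrite inE !label1_padded hf.
rewrite inE => /andP[]; rewrite inE => /orP[/imsetP[h hf ->]|/imsetP[i _ ->]].
  by rewrite label1_padded => hg; exists h; rewrite // inE hf.
rewrite inE => /orP[] /imsetP[j _ /pt_inj[]] // e.
by rewrite e eqxx in fg.
Qed.

Lemma first_matching_disj l f g :
  f \in first_matching l -> g \in first_matching l -> f != g -> disj f g.
Proof.
rewrite !mem_sep => /andP[fS mf] /andP[gS mg] fg; apply: contraT => nfg.
have gf : g \in nb f by rewrite inE gS.
have fg' : f \in nb g by rewrite inE fS disj_sym.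
have lf : (l (label1 f) < l (label1 g))%N.
  by apply: (strict_min_lt mf); rewrite ?label1_padded ?(inj_eq label1_inj) // eq_sym.
have lg : (l (label1 g) < l (label1 f))%N.
  by apply: (strict_min_lt mg); rewrite ?label1_padded ?(inj_eq label1_inj).
by have := ltn_trans lf lg; rewrite ltnn.
Qed.

Lemma free_disj l e f : e \in free_edges l -> f \in first_matching l -> disj e f.
Proof.
rewrite mem_sep => /andP[_ dF] fM; apply: contraT => nef.
have fS : f \in S by move: fM; rewrite mem_sep => /andP[].
by move/pred0P/(_ f): dF; rewrite /= fM andbT inE fS nef.
Qed.

Lemma trial_matching_sub l : trial_matching l \subset S.
Proof. by apply/subsetP => e; rewrite !inE => /orP[/andP[]|/andP[/andP[]]]. Qed.

Lemma trial_matching_disj l e f :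
  e \in trial_matching l -> f \in trial_matching l -> e != f -> disj e f.
Proof.
rewrite !in_setU => /orP[eM|eM] /orP[fM|fM] ef.
- exact: first_matching_disj eM fM ef.
- by rewrite disj_sym (free_disj _ eM) //; move: fM; rewrite mem_sep => /andP[].
- by rewrite (free_disj _ fM) //; move: eM; rewrite mem_sep => /andP[].
move: eM; rewrite mem_sep => /andP[eF me]; move: fM; rewrite mem_sep => /andP[fF mf].
apply: contraT => nef.
have [eS fS] : e \in S /\ f \in S by move: eF fF; rewrite !mem_sep => /andP[? _] /andP[? _].
have lf : (l (label2 e) < l (label2 f))%N.
  apply: (strict_min_lt me); rewrite ?(mem_imset _ _ label2_inj) ?(inj_eq label2_inj).
    by rewrite in_setI fF inE fS nef.
  by rewrite eq_sym.
have lg : (l (label2 f) < l (label2 e))%N.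
  apply: (strict_min_lt mf); rewrite ?(mem_imset _ _ label2_inj) ?(inj_eq label2_inj) //.
  by rewrite in_setI eF inE eS disj_sym nef.
by have := ltn_trans lf lg; rewrite ltnn.
Qed.

Lemma matching_card_le (Q : {set E}) e :
    (forall f g, f \in Q -> g \in Q -> f != g -> disj f g) -> Q \subset nb e ->
  (#|Q| <= 3)%N.
Proof.
move=> dQ /subsetP Qe; rewrite -[leqRHS](card_ends e).
apply: (@leq_trans (\sum_(f in Q) #|ends f :&: ends e|)).
  by rewrite -sum1_card; apply: leq_sum => f /Qe; apply: inter_gt0.
under eq_bigr => f _ do rewrite card_inter.
rewrite exchange_big /= -[leqRHS]sum1_card; apply: leq_sum => v _.
rewrite -card_sep leqNgt; apply/negP => /card_gt1P[f [g [fQ gQ fg]]].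
move: fQ gQ; rewrite !mem_sep => /andP[fQ vf] /andP[gQ vg].
by have := dQ f g fQ gQ fg; apply/negP/disjPn; exists v.
Qed.

(* At most three pairwise disjoint edges meet [e], so Bonferroni's expansion stops at
   triples. *)
Lemma no_hit_expansion (Q A : {set E}) (x : E -> R) e :
    (forall f g, f \in Q -> g \in Q -> f != g -> disj f g) ->
    Q \subset nb e -> A = nb e -> (forall f, x f = (f \in Q)%:R) ->
  (Q == set0)%:R = 1 - \sum_(f in A) x f
    + 2^-1 * (\sum_(f in A) \sum_(g in A | disj f g) x f * x g)
    - 6^-1 * (\sum_(f in A) \sum_(g in A | disj f g)
                \sum_(h in A | disj f h && disj g h) x f * x g * x h).
Proof.
move=> dQ QA AE xE.
have Q3 := matching_card_le dQ QA.
have disjQ f g : f \in Q -> g \in Q -> disj f g = (g != f).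
  move=> fQ gQ; case: eqP => [->|/eqP]; first by rewrite disj_irr.
  by rewrite eq_sym => /(dQ _ _ fQ gQ).
have sumx (P : pred E) : \sum_(f in A | P f) x f = #|[set f in Q | P f]|%:R.
  rewrite card_sep natr_sum big_mkcond [RHS]big_mkcond; apply: eq_bigr => f _.
  rewrite xE AE; case fQ: (f \in Q); last by case: ifP.
  by rewrite (subsetP QA _ fQ); case: (P f).
have sumQ (G : E -> R) : \sum_(f in A) x f * G f = \sum_(f in Q) G f.
  rewrite big_mkcond [RHS]big_mkcond; apply: eq_bigr => f _.
  rewrite xE AE; case fQ: (f \in Q); last by rewrite mul0r; case: ifP.
  by rewrite (subsetP QA _ fQ) mul1r.
have s1 : \sum_(f in A) x f = #|Q|%:R.
  rewrite (eq_bigr (fun f => x f * 1)) => [|f _]; last by rewrite mulr1.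
  by rewrite sumQ sumr_const.
have s2 : \sum_(f in A) \sum_(g in A | disj f g) x f * x g = #|Q|%:R * (#|Q|%:R - 1).
  under eq_bigr => f _ do rewrite -mulr_sumr.
  rewrite sumQ (eq_bigr (fun=> #|Q|%:R - 1)) => [|f fQ].
    by rewrite sumr_const mulr_natl.
  rewrite sumx (cardsD1 f Q) fQ natrD addrAC subrr add0r; congr _%:R.
  apply: eq_card => g; rewrite !inE andbC; case gQ: (g \in Q); rewrite ?andbF //=.
  by rewrite disjQ.
have s3 : \sum_(f in A) \sum_(g in A | disj f g)
     \sum_(h in A | disj f h && disj g h) x f * x g * x h
   = #|Q|%:R * (#|Q|%:R - 1) * (#|Q|%:R - 2).
  transitivity (\sum_(f in A) x f * \sum_(g in A | disj f g) x g * (#|Q|%:R - 2)).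
    apply: eq_bigr => f _; rewrite mulr_sumr; apply: eq_bigr => g /andP[_ fg].
    rewrite mulrA -mulr_sumr sumx !xE.
    case fQ: (f \in Q); rewrite ?mul0r //; case gQ: (g \in Q); rewrite ?mulr0 ?mul0r //.
    have gf : g != f by rewrite -(disjQ f).
    rewrite !mul1r (cardsD1 f Q) fQ (cardsD1 g (Q :\ f)) !inE gf gQ !natrD addrA.
    rewrite -addrA [X in _ = X](_ : _ = #|Q :\ f :\ g|%:R); last by rewrite /=; lra.
    congr _%:R; apply: eq_card => h; rewrite !inE; case hQ: (h \in Q); rewrite ?andbF //=.
    by rewrite !disjQ // andbT andbC.
  under eq_bigr => f _ do rewrite -mulr_suml mulrA mulr_sumr.
  by rewrite -mulr_suml s2.
(* For [q = |Q| <= 3] the right side is [1 - q + C(q,2) - C(q,3)], which is 1 at [q = 0] and 0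
   otherwise. *)
rewrite s1 s2 s3 -cards_eq0; move: Q3; case: #|Q| => [|[|[|[|//]]]] _; rewrite /=; lra.
Qed.

Definition union_size f g := #|padded_nb f :|: padded_nb g|.

Lemma in_first l e f : f \in nb e ->
  (f \in first_matching l) = strict_min l (label1 f) (padded_nb f).
Proof. by move=> fe; rewrite mem_sep (subsetP (nb_sub ends S e) _ fe). Qed.

Lemma label1_padded_self e f : f \in nb e -> label1 f \in padded_nb f.
Proof.
by move=> fe; rewrite label1_padded mem_nb // (subsetP (nb_sub ends S e) _ fe).
Qed.

Lemma label1_padded_disj f g : disj f g -> label1 f \notin padded_nb g.
Proof. by move=> fg; rewrite label1_padded inE disj_sym fg andbF. Qed.

Lemma disj_neq f g : disj f g -> f != g.
Proof. by apply: contraTneq => ->; rewrite disj_irr. Qed.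

Lemma prob_first_le e f : f \in nb e ->
  prob R (fun l => f \in first_matching l) <= N%:R^-1.
Proof.
move=> fe; rewrite -(card_padded f).
apply: le_trans (prob_min_le R K_gt0 (label1_padded_self fe)).
by apply: le_prob => l; rewrite (in_first _ fe).
Qed.

Lemma prob_first_ge e : e \in S ->
  ((K - 1)%N%:R / K%:R) ^+ N / N%:R <= prob R (fun l => e \in first_matching l).
Proof.
move=> eS; have ee := mem_nb card_ends eS.
rewrite -(card_padded e).
apply: le_trans (prob_min_ge R K_gt0 (label1_padded_self ee)) _.
by apply: le_prob => l; rewrite (in_first _ ee).
Qed.

Lemma card_union_ge f g : (N <= union_size f g)%N.
Proof. by rewrite -[leqLHS](card_padded f) subset_leq_card // subsetUl. Qed.

Lemma card_union_le f g : (union_size f g <= 2 * N)%N.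
Proof.
apply: leq_trans (leq_card_setU _ _) _.
by rewrite !card_padded mul2n addnn.
Qed.

Lemma prob_pair_ge e f g : f \in nb e -> g \in nb e -> disj f g ->
  2 / N%:R * (((K - 2)%N%:R / K%:R) ^+ (2 * N) / (union_size f g)%:R)
   <= prob R (fun l => (f \in first_matching l) && (g \in first_matching l)).
Proof.
move=> fe ge fg.
have := prob_min2_ge R K_gt0 (label1_padded_self fe) (label1_padded_self ge)
  (label1_padded_disj fg) (label1_padded_disj _) (card_padded f) (card_padded g).
rewrite disj_sym => /(_ fg) H.
under eq_prob => l do rewrite (in_first _ fe) (in_first _ ge).
apply: le_trans H.
rewrite -mulrA ler_wpM2l // invfM mulrCA ler_wpM2r ?mulr_ge0 ?invr_ge0 ?ler0n //.
apply: ler_wiXn2l (card_union_le f g).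
  by rewrite divr_ge0 ?ler0n.
by rewrite ler_pdivrMr ?ltr0n // mul1r ler_nat leq_subr.
Qed.

Lemma prob_triple_le e f g h : f \in nb e -> g \in nb e -> h \in nb e ->
    disj f g -> disj f h -> disj g h ->
  prob R (fun l => [&& f \in first_matching l, g \in first_matching l
                     & h \in first_matching l])
   <= 2 / N%:R * (((union_size f g)%:R ^+ 2)^-1 + ((union_size f h)%:R ^+ 2)^-1
                   + ((union_size g h)%:R ^+ 2)^-1) + 3 / K%:R.
Proof.
move=> fe ge he fg fh gh.
have gf : disj g f by rewrite disj_sym.
have hf : disj h f by rewrite disj_sym.
have hg : disj h g by rewrite disj_sym.
have H := prob_min3_le R K_gt0 (label1_padded_self fe) (label1_padded_self ge)
  (label1_padded_self he) (label1_padded_disj fg) (label1_padded_disj fh)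
  (label1_padded_disj gf) (label1_padded_disj gh) (label1_padded_disj hf)
  (label1_padded_disj hg) (card_padded f) (card_padded g) (card_padded h).
apply: le_trans H.
by apply: le_prob => l; rewrite (in_first _ fe) (in_first _ ge) (in_first _ he).
Qed.

(** [N] times the pair term minus the triple term of the expansion, tie errors apart: a pair
    contributes [1 / U], and its [t] completions to a triple cost [t / U^2]. *)
Definition gain e : R := \sum_(f in nb e) \sum_(g in nb e | disj f g)
  (union_size f g)%:R^-1 * (1 - (common_disj ends S e f g)%:R / (union_size f g)%:R).

(** Each term is charged to the pair that it mentions; by symmetry the three resulting sums
    agree. *)
Lemma sum_triples e :
  \sum_(f in nb e) \sum_(g in nb e | disj f g) \sum_(h in nb e | disj f h && disj g h)
    (((union_size f g)%:R ^+ 2)^-1 + ((union_size f h)%:R ^+ 2)^-1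
       + ((union_size g h)%:R ^+ 2)^-1)
  = 3 * \sum_(f in nb e) \sum_(g in nb e | disj f g)
      (common_disj ends S e f g)%:R * ((union_size f g)%:R ^+ 2)^-1 :> R.
Proof.
pose T := \sum_(f in nb e) \sum_(g in nb e | disj f g)
      (common_disj ends S e f g)%:R * ((union_size f g)%:R ^+ 2)^-1 : R.
have sym f g : union_size f g = union_size g f by rewrite /union_size setUC.
have t1 : \sum_(f in nb e) \sum_(g in nb e | disj f g)
   \sum_(h in nb e | disj f h && disj g h) ((union_size f g)%:R ^+ 2)^-1 = T.
  apply: eq_bigr => f _; apply: eq_bigr => g _.
  rewrite /common_disj card_sep natr_sum mulr_suml big_mkcondr /=.
  by apply: eq_bigr => h _; case: ifP; rewrite ?mul1r ?mul0r.
have t2 : \sum_(f in nb e) \sum_(g in nb e | disj f g)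
   \sum_(h in nb e | disj f h && disj g h) ((union_size f h)%:R ^+ 2)^-1 = T.
  rewrite -t1; apply: eq_bigr => f _.
  rewrite (exchange_big_dep (fun h => (h \in nb e) && disj f h)) /=; last first.
    by move=> g h _ /and3P[-> ->].
  apply: eq_bigr => h /andP[he fh]; apply: eq_bigl => g.
  by rewrite he fh [disj g h]disj_sym /= andbA.
have t3 : \sum_(f in nb e) \sum_(g in nb e | disj f g)
   \sum_(h in nb e | disj f h && disj g h) ((union_size g h)%:R ^+ 2)^-1 = T.
  rewrite -t2 (exchange_big_dep (mem (nb e))) /=; last by move=> f g _ /andP[].
  apply: eq_bigr => g ge; apply: eq_big => [f|f /andP[_ fg]].
    by rewrite ge [disj f g]disj_sym.
  by apply: eq_bigl => h; rewrite [disj f h && _]andbC.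
under eq_bigr => f _ do under eq_bigr => g _ do rewrite !big_split /=.
under eq_bigr => f _ do rewrite !big_split /=.
by rewrite !big_split /= t1 t2 t3 -/T; ring.
Qed.

(** The factor [2 / N] of pairs meets [1 / 2] and the [6 / N] of triples meets [1 / 6], so both
    enter with weight [1 / N]. The last two terms are errors of discrete labels: the pair sum is at
    most [N], and each of at most [N^3] triples costs [3 / K]. *)
Lemma prob_free_ge e : e \in S ->
  1 - #|nb e|%:R / N%:R + N%:R^-1 * gain e
    - (1 - ((K - 2)%N%:R / K%:R) ^+ (2 * N)) - N%:R ^+ 3 / (2 * K%:R)
  <= prob R (fun l => e \in free_edges l).
Proof.
move=> eS; set A := nb e; set th := _ ^+ (2 * N); set F := first_matching.
have aN : #|A|%:R <= N%:R :> R by rewrite ler_nat (card_nb_le card_ends degS).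
have N0 : (0 < N)%N.
  apply: leq_trans (card_nb_le card_ends degS e); apply/card_gt0P.
  by exists e; apply: mem_nb.
have NR : 0 < N%:R :> R by rewrite ltr0n.
have KR : 0 < K%:R :> R by rewrite ltr0n.
pose q2 f g := prob R (fun l => (f \in F l) && (g \in F l)).
pose q3 f g h := prob R (fun l => [&& f \in F l, g \in F l & h \in F l]).
have -> : prob R (fun l => e \in free_edges l) =
  1 - \sum_(f in A) prob R (fun l => f \in F l)
  + 2^-1 * (\sum_(f in A) \sum_(g in A | disj f g) q2 f g)
  - 6^-1 * (\sum_(f in A) \sum_(g in A | disj f g)
              \sum_(h in A | disj f h && disj g h) q3 f g h).
  pose x l f : R := (f \in A :&: F l)%:R.
  have xE l f : f \in A -> x l f = (f \in F l)%:R by move=> fA; rewrite /x in_setI fA.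
  transitivity (expect (fun l => 1 - \sum_(f in A) x l f
    + 2^-1 * (\sum_(f in A) \sum_(g in A | disj f g) x l f * x l g)
    - 6^-1 * (\sum_(f in A) \sum_(g in A | disj f g)
                \sum_(h in A | disj f h && disj g h) x l f * x l g * x l h))).
    apply: eq_expect => l; rewrite -(@no_hit_expansion (A :&: F l) A (x l) e) //.
    - by rewrite mem_sep eS /= setI_eq0.
    - move=> f g; rewrite !in_setI => /andP[_ fF] /andP[_ gF].
      exact: first_matching_disj fF gF.
    - exact: subsetIl.
  rewrite expectB expectD expectB expect_const ?card_labels_gt0 // !expectZ !expect_sum.
  congr (_ - _ + _ * _ - _ * _).
  - by apply: eq_bigr => f fA; apply: eq_expect => l; rewrite xE.
  - apply: eq_bigr => f fA; rewrite expect_sum; apply: eq_bigr => g /andP[gA _].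
    by apply: eq_expect => l; rewrite !xE // -natrM mulnb.
  apply: eq_bigr => f fA; rewrite expect_sum; apply: eq_bigr => g /andP[gA _].
  rewrite expect_sum; apply: eq_bigr => h /andP[hA _].
  by apply: eq_expect => l; rewrite !xE // -!natrM !mulnb andbA.
have b1 : \sum_(f in A) prob R (fun l => f \in F l) <= #|A|%:R / N%:R.
  apply: (@le_trans _ _ (\sum_(f in A) N%:R^-1)).
    by apply: ler_sum => f; apply: (@prob_first_le e).
  by rewrite sumr_const mulr_natl.
pose P := \sum_(f in A) \sum_(g in A | disj f g) (union_size f g)%:R^-1 : R.
pose T := \sum_(f in A) \sum_(g in A | disj f g)
      (common_disj ends S e f g)%:R * ((union_size f g)%:R ^+ 2)^-1 : R.
have b2 : 2 / N%:R * (th * P) <= \sum_(f in A) \sum_(g in A | disj f g) q2 f g.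
  rewrite !mulr_sumr; apply: ler_sum => f fA; rewrite !mulr_sumr.
  by apply: ler_sum => g /andP[gA fg]; apply: (@prob_pair_ge e).
have b3 : \sum_(f in A) \sum_(g in A | disj f g)
      \sum_(h in A | disj f h && disj g h) q3 f g h
    <= 2 / N%:R * (3 * T) + N%:R ^+ 3 * (3 / K%:R).
  rewrite -sum_triples.
  apply: (@le_trans _ _ (2 / N%:R * (\sum_(f in A) \sum_(g in A | disj f g)
     \sum_(h in A | disj f h && disj g h)
      (((union_size f g)%:R ^+ 2)^-1 + ((union_size f h)%:R ^+ 2)^-1
       + ((union_size g h)%:R ^+ 2)^-1))
     + \sum_(f in A) \sum_(g in A) \sum_(h in A) 3 / K%:R)); last first.
    rewrite lerD2l !sumr_const -!mulrnA -[X in X <= _]mulr_natl ler_wpM2r //.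
      by rewrite divr_ge0 ?ler0n.
    rewrite -natrX ler_nat !expnS expn0 muln1.
    have aN' := card_nb_le card_ends degS e.
    by rewrite leq_mul // leq_mul.
  rewrite mulr_sumr -big_split /=; apply: ler_sum => f fA.
  rewrite [X in _ <= _ + X](bigID (disj f)) /= mulr_sumr addrA.
  apply: ler_wpDr; first by apply: sumr_ge0 => g _; apply: sumr_ge0 => h _; rewrite divr_ge0 ?ler0n.
  rewrite -big_split /=; apply: ler_sum => g /andP[gA fg].
  rewrite [X in _ <= _ + X](bigID (fun h => disj f h && disj g h)) /= mulr_sumr addrA.
  apply: ler_wpDr; first by apply: sumr_ge0 => h _; rewrite divr_ge0 ?ler0n.
  rewrite -big_split /=; apply: ler_sum => h /and3P[hA fh gh].
  exact: (@prob_triple_le e).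
have gE : gain e = P - T.
  rewrite /gain /P /T -sumrB; apply: eq_bigr => f _; rewrite -sumrB.
  by apply: eq_bigr => g _; rewrite expr2 invfM; ring.
have PN : P <= N%:R.
  apply: (@le_trans _ _ (\sum_(f in A) \sum_(g in A) N%:R^-1)).
    apply: ler_sum => f fA; rewrite [leRHS](bigID (disj f)) /=.
    apply: ler_wpDr; first by apply: sumr_ge0 => g _; rewrite invr_ge0 ler0n.
    apply: ler_sum => g _; have := card_union_ge f g.
    by move=> NU; rewrite lef_pV2 ?posrE ?ltr0n ?ler_nat // (leq_trans N0).
  rewrite !sumr_const -mulrnA -[X in X <= _]mulr_natl natrM ler_pdivrMr //.
  by rewrite ler_pM ?ler0n.
have th1 : 0 <= 1 - th.
  rewrite subr_ge0 exprn_ile1 ?divr_ge0 ?ler0n //.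
  by rewrite ler_pdivrMr // mul1r ler_nat leq_subr.
have e2 : N%:R^-1 * ((1 - th) * P) <= 1 - th.
  by rewrite mulrCA -[X in _ <= X]mulr1 ler_wpM2l // mulrC ler_pdivrMr // mul1r.
rewrite gE.
have -> : N%:R ^+ 3 / (2 * K%:R) = 6^-1 * (N%:R ^+ 3 * (3 / K%:R)) :> R.
  by field; rewrite gt_eqF.
move: b2 b3 e2; rewrite -!mulrA [_^-1 * (P - T)]mulrBr mulrBl mul1r mulrBr.
set c1 := N%:R^-1 * P; set c2 := N%:R^-1 * (th * P); rewrite [N%:R^-1 * (3 * T)]mulrCA.
set c3 := N%:R^-1 * T.
lra.
Qed.

Lemma nb_card_bounds e : e \in S -> (0 < #|nb e|)%N /\ (#|nb e| <= N)%N.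
Proof.
move=> eS; split; last exact: (card_nb_le card_ends degS).
by apply/card_gt0P; exists e; apply: mem_nb.
Qed.

Lemma gain_ge0 e : e \in S -> 0 <= gain e.
Proof.
move=> eS; have [a0 aN] := nb_card_bounds eS.
apply: sumr_ge0 => f fA; apply: sumr_ge0 => g /andP[gA fg].
have tD := common_disj_le card_ends degS fA gA fg.
have NU := card_union_ge f g.
rewrite mulr_ge0 ?invr_ge0 ?ler0n // subr_ge0 ler_pdivrMr ?ltr0n; last by lia.
by rewrite mul1r ler_nat; lia.
Qed.

Lemma sum_beta_pairs e :
  \sum_(f in nb e) \sum_(g in nb e | disj f g)
    (8 * D%:R - (beta ends S e f)%:R - (beta ends S e g)%:R)
  = 2 * nonadjacency_sum R ends S D e.
Proof.
pose b f : R := (beta ends S e f)%:R.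
have bE f (c : R) : \sum_(g in nb e | disj f g) c = b f * c.
  rewrite /b /beta card_sep natr_sum mulr_suml big_mkcondr /=.
  by apply: eq_bigr => h _; case: ifP; rewrite ?mul1r ?mul0r.
have s2 : \sum_(f in nb e) \sum_(g in nb e | disj f g) b g
    = \sum_(f in nb e) b f * b f.
  rewrite (exchange_big_dep (mem (nb e))) /=; last by move=> f g _ /andP[].
  apply: eq_bigr => g ge; rewrite -bE; apply: eq_bigl => f.
  by rewrite ge [disj f g]disj_sym.
under eq_bigr => f _ do rewrite sumrB bE.
rewrite sumrB s2 /nonadjacency_sum mulr_sumr -sumrB; apply: eq_bigr => f _.
by rewrite -/(b f); ring.
Qed.

(** Here [U = 6D - |nb f :&: nb g|] is at most [3D + y + bf + bg - t]; with [y <= D / 3] this is the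
    bound that [pair_gain] expects. *)
Lemma gain_ge e (y : R) : e \in S -> y = N%:R - #|nb e|%:R -> y <= D%:R / 3 ->
  135 / 4624 * (2 * nonadjacency_sum R ends S D e) / D%:R ^+ 2 <= gain e.
Proof.
move=> eS yE yD; have [a0 aN] := nb_card_bounds eS.
have D0 : 0 < D%:R :> R by rewrite ltr0n; lia.
rewrite -sum_beta_pairs mulr_sumr mulr_suml; apply: ler_sum => f fA.
rewrite mulr_sumr mulr_suml; apply: ler_sum => g /andP[gA fg].
have fS := subsetP (nb_sub ends S e) _ fA; have gS := subsetP (nb_sub ends S e) _ gA.
have cU := card_paddedU (disj_neq fg).
have cN := common_nb_ge ends e fS gS.
have tD := common_disj_le card_ends degS fA gA fg.
have tf := common_disj_beta_l ends S e f g; have tg := common_disj_beta_r ends S e f g.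
have NU := card_union_ge f g.
apply: pair_gain => //.
- by rewrite -natrM ler_nat.
- move/(congr1 (fun n => n%:R : R)): cU; rewrite natrD !natrM -/(union_size f g) => cU.
  rewrite natrM in yE; move: cN; rewrite -(ler_nat R) !natrD => cN; lra.
- by rewrite ler0n ler_nat.
- by rewrite ler_nat.
- by rewrite ler_nat.
Qed.

Lemma free_main_term e : e \in S ->
  121 / 1000 * (#|nb e|%:R / N%:R) <= 1 - #|nb e|%:R / N%:R + N%:R^-1 * gain e :> R.
Proof.
move=> eS; have [a0 aN] := nb_card_bounds eS.
have NR : 0 < N%:R :> R by rewrite ltr0n; lia.
have D0 : 0 < D%:R :> R by rewrite ltr0n; lia.
pose y : R := N%:R - #|nb e|%:R; pose Y := y / D%:R.
have aE : #|nb e|%:R / N%:R = 1 - Y / 3.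
  by rewrite /Y /y natrM; field; rewrite gt_eqF.
have Y0 : 0 <= Y by apply: divr_ge0; [rewrite subr_ge0 ler_nat | exact: ltW].
(* Beyond [Y = 1 / 3] the deficit [Y / 3 > 1 / 9] suffices alone; up to there the bound linear in
   [Y] works, with almost no slack at the end. *)
rewrite aE; have [yD|yD] := lerP y (D%:R / 3); last first.
  have Y3 : 1 / 3 < Y by rewrite /Y ltr_pdivlMr //; lra.
  have : 0 <= N%:R^-1 * gain e by rewrite mulr_ge0 ?gain_ge0 // invr_ge0 ltW.
  by lra.
have Y3 : Y <= 1 / 3 by rewrite /Y ler_pdivrMr //; lra.
have g1 := gain_ge eS erefl yD.
have g2 : N%:R^-1 * (135 / 4624 * (2 * (20 / 3 * D%:R ^+ 3 - 184 / 9 * D%:R ^+ 2 * y)) / D%:R ^+ 2)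
    <= N%:R^-1 * gain e.
  rewrite ler_wpM2l ?invr_ge0 ?(ltW NR) //; apply: le_trans g1.
  have J := @nonadjacency_sum_ge R V E ends S D card_ends degS e y.
  rewrite ler_wpM2r ?invr_ge0 ?exprn_ge0 ?(ltW D0) //.
  have yE : y = 3 * D%:R - #|nb e|%:R by rewrite /y natrM.
  by have := J yE; lra.
apply: le_trans (lerD (lexx _) g2).
have -> : N%:R^-1 * (135 / 4624 * (2 * (20 / 3 * D%:R ^+ 3 - 184 / 9 * D%:R ^+ 2 * y)) / D%:R ^+ 2)
   = 135 / 4624 * 2 / 3 * (20 / 3 - 184 / 9 * Y) :> R.
  by rewrite /Y natrM; field; rewrite gt_eqF.
by lra.
Qed.

Lemma ratio_pow_ge c n : (c <= K)%N ->
  1 - n%:R * (c%:R / K%:R) <= ((K - c)%N%:R / K%:R) ^+ n :> R.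
Proof.
move=> cK; have KR : 0 < K%:R :> R by rewrite ltr0n.
rewrite natrB // mulrBl divff ?gt_eqF //; apply: bernoulli.
by rewrite divr_ge0 ?ler0n //= ler_pdivrMr // mul1r ler_nat.
Qed.

Definition label_coords (B : {set E}) : {set L} :=
  [set pt p.1 p.2 | p : E * J in [set p | p.1 \in B]].

Lemma label_coords_mem (B : {set E}) e i : e \in B -> pt e i \in label_coords B.
Proof. by move=> eB; apply/imsetP; exists (e, i); rewrite ?inE. Qed.

Lemma label_coordsS (B C : {set E}) : B \subset C -> label_coords B \subset label_coords C.
Proof.
by move=> /subsetP BC; apply: imsetS; apply/subsetP => p; rewrite !inE => /BC.
Qed.

Definition first_coords : {set L} :=
  [set pt p.1 p.2 | p : E * J in [set p | p.2 != Some None]].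
Definition second_coords : {set L} :=
  [set pt p.1 p.2 | p : E * J in [set p | p.2 == Some None]].

Lemma padded_nb_first f : padded_nb f \subset first_coords.
Proof.
apply/subsetP => z /setUP[] /imsetP[g _ ->].
  by apply/imsetP; exists (g, None); rewrite ?inE.
by apply/imsetP; exists (f, Some (Some g)); rewrite ?inE.
Qed.

Lemma padded_nb_coords f : f \in S -> padded_nb f \subset label_coords (nb f).
Proof.
move=> fS; apply/subsetP => z /setUP[] /imsetP[g gf ->].
  exact: label_coords_mem.
by apply: label_coords_mem; apply: mem_nb.
Qed.

Lemma free_edgesE l e :
  (e \in free_edges l) = (e \in S) && [forall f in nb e, f \notin first_matching l].
Proof.
rewrite mem_sep; congr (_ && _); apply/pred0P/forall_inP => [H f fe|H f /=].
  by have := H f; rewrite /= fe => /= ->.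
by case fe: (f \in nb e) => //=; apply/negbTE/H.
Qed.

Lemma first_matching_local (l l' : Om) f :
    f \in S -> (forall z, z \in padded_nb f -> l z = l' z) ->
  (f \in first_matching l) = (f \in first_matching l').
Proof.
move=> fS e; rewrite !mem_sep; congr (_ && _).
apply: (@strict_min_dep L K (label1 f) (padded_nb f) (padded_nb f)) => //.
by rewrite label1_padded mem_nb.
Qed.

Lemma free_edges_dep (X : {set L}) e :
    (forall f, f \in nb e -> padded_nb f \subset X) ->
  depends_on X (fun l => e \in free_edges l).
Proof.
move=> H l l' eqX; rewrite !free_edgesE; congr (_ && _).
apply: eq_forallb_in => f fe; congr (~~ _); apply: first_matching_local.
  exact: (subsetP (nb_sub ends S e) _ fe).
by move=> z /(subsetP (H f fe)); apply: eqX.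
Qed.

Definition nb2 e := \bigcup_(f in nb e) nb f.
Definition nb3 e := \bigcup_(f in nb e) nb2 f.

(** Membership of [e] uses the free status of [nb e], hence the first matching on [nb2 e], hence
    labels owned by [nb3 e]. *)
Lemma trial_matching_dep e :
  depends_on (label_coords (nb3 e)) (fun l => e \in trial_matching l).
Proof.
move=> l l' eqX.
case eS: (e \in S); last first.
  have H l0 : (e \in trial_matching l0) = false.
    by apply/negbTE; apply: contraFN eS; apply: (subsetP (trial_matching_sub l0)).
  by rewrite !H.
have ee : e \in nb e by apply: mem_nb.
have free f : f \in nb e -> (f \in free_edges l) = (f \in free_edges l').
  move=> fe; apply: (@free_edges_dep (label_coords (nb3 e))) => // g gf.
  apply: subset_trans (padded_nb_coords (subsetP (nb_sub ends S f) _ gf)) _.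
  apply: label_coordsS; apply: subset_trans (bigcup_sup f fe).
  exact: (bigcup_sup g gf).
have nb_e3 f : f \in nb e -> f \in nb3 e.
  move=> fe; apply/bigcupP; exists e => //; apply/bigcupP; exists e => //.
rewrite !in_setU; congr (_ || _).
  apply: first_matching_local => // z /(subsetP (padded_nb_coords eS)) zX.
  apply: eqX; apply: (subsetP _ _ zX); apply: label_coordsS.
  by apply/subsetP => f; apply: nb_e3.
rewrite [LHS]mem_sep [RHS]mem_sep; congr (_ && _); first exact: free.
have -> : nb e :&: free_edges l = nb e :&: free_edges l'.
  by apply/setP => f; rewrite !in_setI; case fe: (f \in nb e) => //=; apply: free.
apply: (@strict_min_dep L K _ _ (label_coords (nb3 e))) => //.
  by apply: label_coords_mem; apply: nb_e3.
apply/subsetP => z /imsetP[f /setIP[fe _] ->].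
by apply: label_coords_mem; apply: nb_e3.
Qed.

(** Freeness is decided by first-round labels and dummies, independently of the second round; a
    minimum over all of [nb e] is one over its free part. *)
Lemma prob_second_ge e : e \in S ->
  prob R (fun l => e \in free_edges l) * (((K - 1)%N%:R / K%:R) ^+ #|nb e| / #|nb e|%:R)
   <= prob R (fun l => e \in second_matching l).
Proof.
move=> eS; pose X2 := [set label2 f | f in nb e].
have eX2 : label2 e \in X2 by apply: imset_f; apply: mem_nb.
have cX2 : #|X2| = #|nb e| by apply: card_imset; apply: label2_inj.
apply: (@le_trans _ _ (prob R (fun l => (e \in free_edges l) && strict_min l (label2 e) X2))).
  rewrite (@probM_indep R L K K_gt0 first_coords second_coords).
  - by rewrite -cX2 ler_wpM2l ?prob_ge0 ?prob_min_ge.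
  - by apply: free_edges_dep => f _; apply: padded_nb_first.
  - apply: strict_min_dep.
      by apply/imsetP; exists (e, Some None); rewrite ?inE.
    apply/subsetP => z /imsetP[f _ ->].
    by apply/imsetP; exists (f, Some None); rewrite ?inE.
  rewrite -setI_eq0; apply/eqP/setP => z; rewrite !inE; apply/negP => /andP[].
  case/imsetP => -[f i]; rewrite inE /= => ni -> /imsetP[[g j]]; rewrite inE /= => /eqP -> .
  by case/pt_inj => _ ij; rewrite ij eqxx in ni.
apply: le_prob => l /andP[eF m]; rewrite mem_sep eF.
by apply: strict_minS m; apply: imsetS; apply: subsetIl.
Qed.

(** [467 / 1250 / D] is [1.1208 / N], leaving [0.0002 / N] out of [1.121 / N] for tie errors. The
    fourth power of [N] is needed since the error [N^3 / K] is divided by [|nb e|], known only to be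
    at least 1, and must still be small against [1 / N]. *)
Lemma prob_trial_ge e : e \in S -> 100 * 1000 * N%:R ^+ 4 <= K%:R :> R ->
  467 / 1250 / D%:R <= prob R (fun l => e \in trial_matching l).
Proof.
move=> eS NK; have [a0 aN] := nb_card_bounds eS.
have NR : 1 <= N%:R :> R by rewrite ler1n; lia.
have KR : 0 < K%:R :> R by rewrite ltr0n.
have D0 : 0 < D%:R :> R by rewrite ltr0n; lia.
have N4 : 0 <= N%:R ^+ 4 :> R by rewrite exprn_ge0 ?ler0n.
have N1 k : (k <= 4)%N -> N%:R ^+ k <= N%:R ^+ 4 :> R by move=> k4; apply: ler_weXn2l.
have -> : prob R (fun l => e \in trial_matching l)
    = prob R (fun l => e \in first_matching l) + prob R (fun l => e \in second_matching l).
  rewrite /prob -expectD; apply: eq_expect => l; rewrite in_setU.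
  case e1: (e \in first_matching l); last by rewrite add0r.
  case e2: (e \in second_matching l); last by rewrite addr0.
  move: e2; rewrite mem_sep => /andP[/free_disj/(_ e1)].
  by rewrite disj_irr.
have p1 := prob_first_ge eS; have p2 := prob_second_ge eS; have pf := prob_free_ge eS.
have main := free_main_term eS.
have K2 : (2 <= K)%N.
  rewrite -(ler_nat R); apply: le_trans NK.
  have := N1 0%N isT; rewrite expr0; lra.
have r1 := @ratio_pow_ge 1 N K_gt0.
have r1a := @ratio_pow_ge 1 #|nb e| K_gt0.
have r2 := @ratio_pow_ge 2 (2 * N) K2.
set a : R := #|nb e|%:R in main pf p2 r1a.
have aR : 1 <= a by rewrite /a ler1n.
have aNR : a <= N%:R by rewrite /a ler_nat.
pose eps : R := (N%:R ^+ 4)/ K%:R.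
have eps0 : 0 <= eps by rewrite divr_ge0 ?(ltW KR).
have epsb : eps <= 1 / (100 * 1000) by rewrite ler_pdivrMr //; lra.
have NKe : N%:R / K%:R <= eps.
  by rewrite ler_wpM2r ?invr_ge0 ?(ltW KR) // -{1}[N%:R]expr1 N1.
have NNK : N%:R ^+ 2 / K%:R <= eps by rewrite ler_wpM2r ?invr_ge0 ?(ltW KR) ?N1.
set F := prob R (fun l => e \in free_edges l) in p2 pf.
have Fb : 121 / 1000 * (a / N%:R) - 4 * (N%:R / K%:R) - N%:R ^+ 3 / (2 * K%:R) <= F.
  apply: le_trans pf; move: r2; rewrite natrM => r2.
  have -> : 4 * (N%:R / K%:R) = 2 * N%:R * (2 / K%:R) :> R by ring.
  by lra.
have q1 : (1 - eps) / N%:R <= prob R (fun l => e \in first_matching l).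
  apply: le_trans p1; rewrite ler_wpM2r ?invr_ge0 ?ler0n //; apply: le_trans r1.
  by rewrite mul1r -/(N%:R / K%:R); lra.
have q2 : (1 - eps) * (121 / 1000 - 5 * eps) / N%:R
    <= prob R (fun l => e \in second_matching l).
  apply: le_trans p2; rewrite -mulrA [leRHS]mulrCA.
  have x1 : 1 - eps <= ((K - 1)%N%:R / K%:R) ^+ #|nb e|.
    apply: le_trans r1a; rewrite mul1r lerD2l lerN2; apply: le_trans NKe.
    by rewrite ler_wpM2r ?invr_ge0 // ltW.
  have x2 : (121 / 1000 - 5 * eps) / N%:R <= F / a.
    rewrite ler_pdivlMr; last by lra.
    apply: le_trans Fb.
    have -> : (121 / 1000 - 5 * eps) / N%:R * a
       = 121 / 1000 * (a / N%:R) - 5 * (eps / N%:R) * a by ring.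
    rewrite -addrA lerD2l -opprD lerN2.
    apply: (@le_trans _ _ (5 * (eps / N%:R) * 1)); last first.
      by rewrite ler_wpM2l // mulr_ge0 // divr_ge0 // ler0n.
    have -> : eps / N%:R = N%:R ^+ 3 / K%:R :> R.
      by rewrite /eps; field; rewrite !gt_eqF //; lra.
    have : N%:R / K%:R <= N%:R ^+ 3 / K%:R :> R.
      by rewrite ler_wpM2r ?invr_ge0 ?(ltW KR) // -{1}[N%:R]expr1 ler_weXn2l.
    have -> : N%:R ^+ 3 / (2 * K%:R) = 2^-1 * (N%:R ^+ 3 / K%:R) :> R.
      by field; rewrite gt_eqF.
    have : 0 <= N%:R ^+ 3 / K%:R :> R by rewrite divr_ge0 ?exprn_ge0 ?ler0n.
    by lra.
  apply: ler_pM => //; first by lra.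
  by apply: divr_ge0; [lra | rewrite ler0n].
have := lerD q1 q2; apply: le_trans.
rewrite -mulrDl; have -> : 467 / 1250 / D%:R = 1401 / 1250 / N%:R :> R.
  by rewrite natrM; field; rewrite gt_eqF.
rewrite ler_wpM2r ?invr_ge0 ?ler0n //.
have : eps * eps >= 0 by rewrite mulr_ge0.
by lra.
Qed.

End Trial.

(** * The local lemma and an exponential moment bound *)


Section LocalLemma.
Variables (R : realFieldType) (Om V : finType).
Variables (bad : V -> pred Om) (near : V -> {set V}) (d : nat).
Implicit Types (v w : V) (X Y : {set V}).

Definition all_good X : pred Om := fun o => [forall w in X, ~~ bad w o].

Hypothesis Om_gt0 : (0 < #|Om|)%N.
Hypothesis d_gt0 : (0 < d)%N.
Hypothesis near_le : forall v, (#|near v| <= d)%N.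
Hypothesis bad_indep : forall v X, [disjoint X & near v] ->
  prob R (fun o => bad v o && all_good X o) = prob R (bad v) * prob R (all_good X).
Hypothesis bad_le : forall v, 4 * d%:R * prob R (bad v) <= 1.

Lemma all_goodS X Y : X \subset Y -> forall o, all_good Y o -> all_good X o.
Proof. by move=> /subsetP XY o /forall_inP g; apply/forall_inP => w /XY; apply: g. Qed.

Lemma all_good_split X Y : 
  prob R (all_good Y) <= prob R (all_good (X :|: Y))
     + \sum_(w in X) prob R (fun o => bad w o && all_good Y o).
Proof.
rewrite /prob -expect_sum -expectD; apply: le_expect => o.
case: (boolP (all_good Y o)) => gY; last first.
  by rewrite addr_ge0 ?ler0n ?sumr_ge0 // => *; rewrite ler0n.
case: (boolP (all_good (X :|: Y) o)) => [_|].
  by rewrite lerDl sumr_ge0 // => *; rewrite ler0n.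
rewrite negb_forall_in => /exists_inP[w]; rewrite negbK => wXY bw.
rewrite add0r; have wX : w \in X.
  case/setUP: wXY => // wY; move/forall_inP: gY => /(_ w wY).
  by rewrite bw.
rewrite (bigD1 w) //= bw lerDl sumr_ge0 // => *; by rewrite ler0n.
Qed.

(** Induction on [|X|], in a form free of division. Given the good events outside [near v],
    independence bounds [bad v] by [1 / (4d)]; restoring at most [d] events, each failing with
    conditional probability at most [1 / (2d)], at most halves the conditioning event. *)
Lemma bad_given_good v X :
  2 * d%:R * prob R (fun o => bad v o && all_good X o) <= prob R (all_good X).
Proof.
have [n] := ubnP #|X|; elim: n v X => // n IHn v X Xn.
pose X1 := X :&: near v; pose X2 := X :\: near v.
have XE : X = X1 :|: X2 by rewrite setID.
have dX2 : [disjoint X2 & near v].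
  by rewrite -setI_eq0; apply/eqP/setP => w; rewrite !inE; case: (w \in near v); rewrite ?andbF.
have X2X : X2 \subset X by apply: subsetDl.
have le1 : prob R (fun o => bad v o && all_good X o) <= prob R (bad v) * prob R (all_good X2).
  by rewrite -bad_indep //; apply: le_prob => o /andP[-> /(all_goodS X2X) ->].
have g0 : 0 <= prob R (all_good X2) by apply: prob_ge0.
have d0 : 0 < d%:R :> R by rewrite ltr0n.
have le2 : 4 * d%:R * (prob R (bad v) * prob R (all_good X2)) <= prob R (all_good X2).
  by rewrite mulrA -[leRHS]mul1r ler_wpM2r.
have le3 : 4 * d%:R * prob R (fun o => bad v o && all_good X o)
    <= 4 * d%:R * (prob R (bad v) * prob R (all_good X2)).
  by rewrite ler_wpM2l // mulr_ge0 // ltW.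
suff half : prob R (all_good X2) <= 2 * prob R (all_good X) by lra.
have := all_good_split X1 X2; rewrite -XE.
suff : \sum_(w in X1) prob R (fun o => bad w o && all_good X2 o) <= 2^-1 * prob R (all_good X2).
  by lra.
have bw w : w \in X1 -> prob R (fun o => bad w o && all_good X2 o)
    <= (2 * d%:R)^-1 * prob R (all_good X2).
  move=> wX1; rewrite ler_pdivlMl ?mulr_gt0 //; apply: IHn.
  rewrite -ltnS; apply: leq_trans Xn; rewrite ltnS; apply: proper_card.
  apply/properP; split => //.
  move: wX1; rewrite inE => /andP[wX wv]; exists w => //.
  by rewrite inE wv.
apply: (@le_trans _ _ (\sum_(w in X1) (2 * d%:R)^-1 * prob R (all_good X2))).
  by apply: ler_sum.
rewrite sumr_const -[leLHS]mulr_natl mulrA.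
rewrite ler_wpM2r // invfM mulrCA -[leRHS]mulr1 ler_wpM2l ?invr_ge0 //.
rewrite ler_pdivrMr // mul1r ler_nat (leq_trans _ (near_le v)) // subset_leq_card //.
exact: subsetIr.
Qed.

Lemma all_good_gt0 n X : (#|X| <= n)%N -> 0 < prob R (all_good X).
Proof.
elim: n X => [|n IHn] X Xn.
  have -> : X = set0 by apply/eqP; rewrite -cards_eq0 -leqn0.
  by rewrite probT // => o; apply/forall_inP => w; rewrite inE.
have [->|[v vX]] := set_0Vmem X.
  by rewrite probT // => o; apply/forall_inP => w; rewrite inE.
have Xv : (#|X :\ v| <= n)%N by move: Xn; rewrite (cardsD1 v X) vX.
have g0 := IHn _ Xv.
have := all_good_split [set v] (X :\ v); rewrite setD1K // big_set1.
have := bad_given_good v (X :\ v).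
have d1 : 1 <= d%:R :> R by rewrite ler1n.
set b := prob R (fun o => _); have b0 : 0 <= b by apply: prob_ge0.
have : b <= d%:R * b by rewrite -[leLHS]mul1r ler_wpM2r.
lra.
Qed.

Lemma local_lemma : exists o, forall v, ~~ bad v o.
Proof.
have [o /forall_inP g] := prob_exists Om_gt0 (all_good_gt0 (leqnn #|[set: V]|)).
by exists o => v; apply: g; rewrite inE.
Qed.

End LocalLemma.

(** * Distinct edges hit by independent trials *)

Section Moment.
Variables (R : realFieldType) (L E : finType) (K T : nat).
Hypothesis K_gt0 : (0 < K)%N.
Local Notation Om := {ffun L -> 'I_K}.
Variables (A : 'I_T -> E -> pred Om) (B : {set E}) (X : 'I_T -> {set L}) (p x : R).
Implicit Types (l : Om) (e f : E) (C : {set E}).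
Hypothesis A_once : forall i l e f, e \in B -> f \in B -> A i e l -> A i f l -> e = f.
Hypothesis A_dep : forall i e, depends_on (X i) (A i e).
Hypothesis X_disj : forall i j, i != j -> [disjoint X i & X j].
Hypothesis A_prob : forall i e, e \in B -> p <= prob R (A i e).
Hypothesis p_ge0 : 0 <= p.
Hypothesis x_ge0 : 0 <= x.
Hypothesis x_le1 : x <= 1.
Local Notation rate := (1 - (1 - x) * ((#|B|%:R - T%:R) * p)).
Hypothesis rate_ge0 : 0 <= rate.

Definition hit k l : {set E} := [set e in B | [exists i : 'I_T, (i < k)%N && A i e l]].

(** A trial contains at most one edge of [B], so the count grows by 0 or 1 and the new factor is
    linear in the indicators. *)
Lemma hit_step (i : 'I_T) l :
  x ^+ #|hit i.+1 l| = x ^+ #|hit i l| * (1 - (1 - x) * \sum_(e in B :\: hit i l) (A i e l)%:R).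
Proof.
have hitS e : e \in hit i.+1 l = (e \in hit i l) || (e \in B) && A i e l.
  rewrite !inE; case eB: (e \in B) => //=; apply/existsP/orP.
    case=> j /andP[]; rewrite ltnS leq_eqVlt => /orP[/eqP/val_inj->|ji] Aj; first by right.
    by left; apply/existsP; exists j; rewrite ji.
  case=> [/existsP[j /andP[ji Aj]]|Ai]; first by exists j; rewrite ltnW.
  by exists i; rewrite ltnSn.
case: (pickP (fun e => (e \in B :\: hit i l) && A i e l)) => [e /andP[eBh Ae]|none].
  have [eh eB] : e \notin hit i l /\ e \in B by move: eBh; rewrite inE => /andP[].
  have -> : hit i.+1 l = e |: hit i l.
    apply/setP => f; rewrite hitS in_setU1 orbC; case fh: (f \in hit i l); rewrite ?orbT //.
    rewrite !orbF; apply/andP/eqP => [[fB Af]|->//]; exact: (A_once fB eB Af Ae).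
  rewrite cardsU1 eh add1n exprS (bigD1 e) //= Ae big1 => [|f /andP[fBh fe]].
    by rewrite addr0 mulr1 subKr mulrC.
  case Af: (A i f l) => //; case/eqP: fe; apply: (@A_once i l) => //.
  by move: fBh; rewrite inE => /andP[].
rewrite big1 ?mulr0 ?subr0 ?mulr1 => [|e eBh]; last first.
  by have := none e; rewrite eBh /= => ->.
congr (x ^+ _); apply: eq_card => e; rewrite hitS.
case eh: (e \in hit i l) => //=; have := none e; rewrite in_setD eh /= => <-.
by case: (e \in B).
Qed.

Lemma hit_card k l : (k <= T)%N -> (#|hit k l| <= k)%N.
Proof.
elim: k => [|k IHk] kT.
  rewrite leqn0 cards_eq0; apply/eqP/setP => e; rewrite !inE.
  by apply/negbTE; rewrite negb_and; apply/orP; right; apply/existsP => -[i].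
have kT' : (k < T)%N by [].
apply: (@leq_trans (#|hit k l| + #|[set e in B | A (Ordinal kT') e l]|)).
  apply: leq_trans (leq_card_setU _ _); apply/subset_leq_card/subsetP => e.
  rewrite !inE => /andP[eB /existsP[i /andP[ik Ai]]]; rewrite eB /=.
  move: ik; rewrite ltnS leq_eqVlt => /orP[/eqP ik|ik].
    by rewrite (_ : Ordinal kT' = i) ?Ai ?orbT //; apply: val_inj.
  by apply/orP; left; apply/existsP; exists i; rewrite ik.
rewrite -addn1 leq_add ?IHk ?(ltnW kT) // leqNgt; apply/negP => /card_gt1P[e [f [+ + ef]]].
rewrite !inE => /andP[eB Ae] /andP[fB Af].
by rewrite (A_once eB fB Ae Af) eqxx in ef.
Qed.

Lemma hit_dep (i : 'I_T) (g : {set E} -> R) :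
  depends_on (\bigcup_(j : 'I_T | (j < i)%N) X j) (fun l => g (hit i l)).
Proof.
move=> l l' e; congr g; apply/setP => f; rewrite !inE; congr (_ && _).
apply: eq_existsb => j; case ji: (j < i)%N => //=; apply: A_dep => z zX.
by apply: e; apply/bigcupP; exists j.
Qed.

(** Condition on the set [C] already hit. It has at most [T] edges, so the next, independent trial
    hits a new edge with probability at least [(|B| - T) p]. *)
Lemma moment_le k : (k <= T)%N -> expect (fun l => x ^+ #|hit k l|) <= rate ^+ k.
Proof.
elim: k => [|k IHk] kT.
  rewrite (eq_expect (g := fun=> 1)) ?expect_const ?card_labels_gt0 // => l.
  by have := hit_card l kT; rewrite leqn0 => /eqP ->.
have kT' : (k < T)%N by []; pose i := Ordinal kT'.
rewrite (eq_expect (@hit_step i)) exprSr.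
apply: le_trans (_ : expect (fun l => x ^+ #|hit k l|) * rate <= _); last first.
  by rewrite ler_wpM2r // IHk // ltnW.
have ind (Y : {set E} -> R) l : Y (hit k l) = \sum_C (hit k l == C)%:R * Y C.
  rewrite (bigD1 (hit k l)) //= eqxx mul1r big1 ?addr0 // => C.
  by rewrite eq_sym => /negPf ->; rewrite mul0r.
pose G C l : R := x ^+ #|C| * (1 - (1 - x) * \sum_(e in B :\: C) (A i e l)%:R).
rewrite (eq_expect (g := fun l => \sum_C (hit k l == C)%:R * G C l)); last first.
  by move=> l; rewrite -[LHS]/(G (hit k l) l) (ind (fun C => G C l)).
rewrite [X in _ <= X * _](eq_expect (g := fun l =>
  \sum_C (hit k l == C)%:R * x ^+ #|C|)); last first.
  by move=> l; rewrite (ind (fun C => x ^+ #|C|)).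
rewrite !expect_sum mulr_suml; apply: ler_sum => C _.
have dj : [disjoint \bigcup_(j : 'I_T | (j < i)%N) X j & X i].
  rewrite -setI_eq0; apply/eqP/setP => z; rewrite !inE; apply/negP => /andP[/bigcupP[j ji zj] zi].
  have ij : j != i by apply: contraTneq ji => ->; rewrite ltnn.
  by move/pred0P/(_ z): (X_disj ij); rewrite /= zj zi.
rewrite (@expectM_indep R L K K_gt0 _ (X i) _ _ (hit_dep (fun Y => (Y == C)%:R)) _ dj); last first.
  move=> l l' e; rewrite /G; congr (_ * (1 - _ * _)); apply: eq_bigr => f _.
  by rewrite (A_dep f e).
rewrite [X in _ <= X * _](eq_expect (g := fun l => x ^+ #|C| * (hit k l == C)%:R)); last first.
  by move=> l; rewrite mulrC.
have -> : expect (G C) = x ^+ #|C| *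
    expect (fun l => 1 - (1 - x) * \sum_(e in B :\: C) (A i e l)%:R) by rewrite /G expectZ.
rewrite [X in _ <= X * _]expectZ -[nat_of_ord i]/k.
set P := expect (fun l => (hit k l == C)%:R : R).
rewrite [x ^+ #|C| * P]mulrC -[leRHS]mulrA.
have [Ck|kC] := leqP #|C| k; last first.
  suff -> : P = 0 by rewrite !mul0r.
  rewrite /P (eq_expect (g := fun=> 0)) ?expect_const ?card_labels_gt0 // => l.
  case: eqP => // hC; have := hit_card l (ltnW kT).
  by rewrite hC leqNgt kC.
rewrite ler_wpM2l //; first by apply: expect_ge0 => l; rewrite ler0n.
rewrite ler_wpM2l ?exprn_ge0 //.
rewrite expectB expect_const ?card_labels_gt0 // expectZ expect_sum.
rewrite lerD2l lerN2 ler_wpM2l ?subr_ge0 //.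
apply: (@le_trans _ _ (\sum_(e in B :\: C) p)); last first.
  by apply: ler_sum => e; rewrite inE => /andP[_ eB]; apply: A_prob.
rewrite sumr_const -[leRHS]mulr_natl ler_wpM2r // lerBlDr -natrD ler_nat.
have : (#|C| <= T)%N by apply: leq_trans Ck (ltnW kT).
have := subset_leq_card (subsetIr B C); have := cardsD B C; lia.
Qed.

Lemma prob_few_hits s :
  x ^+ s * prob R (fun l => (#|hit T l| <= s)%N) <= rate ^+ T.
Proof.
apply: le_trans (moment_le (leqnn T)); rewrite /prob -expectZ; apply: le_expect => l.
case: leqP => [h|_]; last by rewrite mulr0 exprn_ge0.
by rewrite mulr1; apply: ler_wiXn2l.
Qed.

End Moment.

(** * Lowering the degree *)


Lemma bernoulli_pos (R : realFieldType) (x : R) n : 0 <= x -> 1 + n%:R * x <= (1 + x) ^+ n.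
Proof.
move=> x0; elim: n => [|n IHn]; first by rewrite mul0r addr0 expr0.
rewrite exprSr; apply: (@le_trans _ _ ((1 + n%:R * x) * (1 + x))).
  have : 0 <= n%:R * (x * x) :> R by rewrite !mulr_ge0 ?ler0n.
  rewrite -natr1; lra.
by rewrite ler_wpM2r // addr_ge0.
Qed.

(** The exponent 7 is the power of [D] in the dependency degree of the local lemma. With
    [rho = 1 / (1 + eta)] and [k = m / 8], Bernoulli gives [(1 + eta)^m >= (k eta)^8], one power of
    [k] to spare. *)
Lemma geometric_beats_degree7 (R : archiRealFieldType) (rho c : R) :
    0 < rho < 1 -> 0 <= c ->
  exists m0 : nat, forall m : nat, (m0 <= m)%N -> c * m.+1%:R ^+ 7 * rho ^+ m <= 1.
Proof.
move=> /andP[rho0 rho1] c0; pose eta := rho^-1 - 1.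
have eta0 : 0 < eta by rewrite subr_gt0 invf_gt1.
pose b := c * 16 ^+ 7 / eta ^+ 8.
have b0 : 0 <= b by rewrite !mulr_ge0 ?invr_ge0 ?exprn_ge0 // ltW.
exists (8 * (Num.Def.archi_bound b).+1)%N => m m0m.
pose k := (m %/ 8)%N.
have kb : (Num.Def.archi_bound b < k)%N.
  by rewrite /k leq_divRL // mulnC.
have k1 : 1 <= k%:R :> R by rewrite ler1n; lia.
have bk : b <= k%:R.
  by apply: ltW; apply: lt_trans (archi_boundP b0) _; rewrite ltr_nat.
have mk : m.+1%:R <= 16 * k%:R :> R.
  rewrite -natrM ler_nat; have := divn_eq m 8; have := @ltn_pmod m 8 isT.
  rewrite -/k; lia.
have rhoE : rho = (1 + eta)^-1 by rewrite /eta addrC subrK invrK.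
have e1 : 0 < 1 + eta by rewrite addr_gt0.
have pow : (k%:R * eta) ^+ 8 <= (1 + eta) ^+ m.
  apply: (@le_trans _ _ (((1 + eta) ^+ k) ^+ 8)).
    have ke : 0 <= k%:R * eta by rewrite mulr_ge0 ?ler0n ?(ltW eta0).
    rewrite lerXn2r ?nnegrE ?exprn_ge0 ?(ltW e1) //.
    have := bernoulli_pos k (ltW eta0); lra.
  rewrite -exprM ler_weXn2l //; first by rewrite lerDl ltW.
  by rewrite [leqRHS](divn_eq m 8) leq_addr.
rewrite rhoE exprVn ler_pdivrMr ?exprn_gt0 // mul1r; apply: le_trans pow.
apply: (@le_trans _ _ (c * (16 * k%:R) ^+ 7)).
  by rewrite ler_wpM2l // lerXn2r // nnegrE ?mulr_ge0 ?ler0n.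
have cb : c * 16 ^+ 7 <= k%:R * eta ^+ 8 by rewrite -ler_pdivrMr ?exprn_gt0.
rewrite [leRHS](_ : _ = k%:R * eta ^+ 8 * k%:R ^+ 7); last by rewrite exprMn exprSr; ring.
by rewrite exprMn mulrA ler_wpM2r // exprn_ge0 ?ler0n.
Qed.

Section Constants.
Variable R : realFieldType.

(* [shrink] is the base of the exponential moment.  A trial adds a new edge at a vertex of
   almost full degree with probability at least [2801 / 7500], and
   [75 * 2801 / 7500 > 28] makes [failure < 1]. *)
Definition shrink : R := 1 - 1 / (100 * 1000).
Definition hit_rate : R := 1 - (1 - shrink) * (2801 / (75 * 100)).
Definition failure : R := hit_rate ^+ 75 / shrink ^+ 28.

(** Up to [75m] edges are missing from full degree and [75m] more may already be hit, a relative
    loss of at most [1 / 5000]; it fits between [467 / 1250 = 2802 / 7500] and [2801 / 7500]. *)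
Lemma rate_bounds (D s m : R) : 750 * 1000 * m <= D -> 0 <= m -> 0 < D ->
    D - 75 * m <= s -> s <= D ->
  2801 / (75 * 100) <= (s - 75 * m) * (467 / 1250 / D) <= 1.
Proof.
move=> mD m0 D0 sD Ds; rewrite mulrA.
by apply/andP; split; rewrite ?ler_pdivlMr ?ler_pdivrMr //; lra.
Qed.

Lemma shrink_gt0 : 0 < shrink. Proof. by rewrite /shrink; lra. Qed.
Lemma shrink_le1 : shrink <= 1. Proof. by rewrite /shrink; lra. Qed.
Lemma hit_rate_gt0 : 0 < hit_rate. Proof. by rewrite /hit_rate /shrink; lra. Qed.

Lemma failure_bounds : 0 < failure < 1.
Proof.
have s0 := shrink_gt0; have h0 := hit_rate_gt0.
rewrite /failure divr_gt0 ?exprn_gt0 //= ltr_pdivrMr ?exprn_gt0 // mul1r.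
set e : R := 1 - shrink; set u : R := e * (2801 / (75 * 100)).
have eE : e = 1 / (100 * 1000) by rewrite /e /shrink; lra.
have u0 : 0 <= u by rewrite /u eE; lra.
have u1 : u <= 1 by rewrite /u eE; lra.
have hE : hit_rate = 1 - u by [].
have b1 := bernoulli_pos 75 u0.
have b2 : 1 - 28%:R * e <= shrink ^+ 28.
  have -> : shrink = 1 - e by rewrite /e; lra.
  by apply: bernoulli; rewrite eE; lra.
have prod : hit_rate ^+ 75 * (1 + u) ^+ 75 <= 1.
  rewrite -exprMn hE exprn_ile1 //; first by apply: mulr_ge0; lra.
  have : 0 <= u * u by rewrite mulr_ge0.
  lra.
have pos : 0 < (1 + u) ^+ 75 by rewrite exprn_gt0 //; lra.
rewrite -(ltr_pM2r pos); apply: le_lt_trans prod _.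
(* As [75 u = 28.01 e], the product is [1 + 0.01 e - 784.28 e^2], above 1 only for [e] below about
   [1.27 / 10^5]; hence the choice of [shrink]. *)
apply: (@lt_le_trans _ _ ((1 - 28%:R * e) * (1 + 75%:R * u))).
  by rewrite /u eE; lra.
by apply: ler_pM; rewrite ?eE //; lra.
Qed.

End Constants.

Lemma card_bigcup_le (I T : finType) (A : {set I}) (F : I -> {set T}) b :
  (forall i, i \in A -> #|F i| <= b)%N -> (#|\bigcup_(i in A) F i| <= #|A| * b)%N.
Proof.
move=> Fb; rewrite -sum_nat_const.
apply: (@leq_trans (\sum_(i in A) #|F i|)); last exact: leq_sum.
elim/big_rec2: _ => [|i y1 y2 _ IH]; first by rewrite cards0.
by apply: leq_trans (leq_card_setU _ _) _; rewrite leq_add2l.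
Qed.

(** * One round of [75m] colours *)

Section Step.
Variables (R : realFieldType) (V E : finType) (ends : E -> {set V}).
Variables (S : {set E}) (D m K : nat).
Hypothesis card_ends : forall e, #|ends e| = 3%N.
Hypothesis degS : forall v, (#|[set f in S | v \in ends f]| <= D)%N.
Local Notation N := (3 * D)%N.
Local Notation T := (75 * m)%N.
Local Notation J := (option (option 'I_N)).
Local Notation L := ('I_T * (E * J))%type.
Local Notation Om := {ffun L -> 'I_K}.
Local Notation nb := (nb ends S).
Local Notation nb2 := (nb2 ends S).
Local Notation nb3 := (nb3 ends S).
Local Notation dep := (D * N ^ 3 * (N ^ 3 * 3))%N.
Hypothesis K_gt0 : (0 < K)%N.
Hypothesis m_gt0 : (0 < m)%N.
Hypothesis mD : 750 * 1000 * m%:R <= D%:R :> R.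
Hypothesis K_large : 100 * 1000 * N%:R ^+ 4 <= K%:R :> R.
Hypothesis rare : 4 * dep%:R * failure R ^+ m <= 1.
Implicit Types (l : Om) (i : 'I_T) (v w : V) (e f g h : E).

Definition coord i e (j : J) : L := (i, (e, j)).

Lemma coord_inj i e f (j k : J) : coord i e j = coord i f k -> e = f /\ j = k.
Proof. by case=> -> ->. Qed.

Definition matching i l := trial_matching ends S (coord i) l.
Definition star v := [set e in S | v \in ends e].
Definition hits v l := hit (fun i e l => e \in matching i l) (star v) T l.
(** Vertices already within the target degree are never bad, so the moment bound is needed only near
    full degree. *)
Definition bad v : pred Om := fun l => (D - 28 * m < #|star v|)%N && (#|hits v l| <= 28 * m)%N.

Definition ball v := \bigcup_(e in star v) nb3 e.
(** If [ball v] and [ball w] share an edge [h], some edge at [w] lies in [nb3 h] by symmetry, so [w]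
    is in [close v]. Outside [close v] the events thus read other labels. *)
Definition close v := \bigcup_(h in ball v) \bigcup_(e in nb3 h) ends e.
Definition coords (B : {set E}) : {set L} := [set z : L | z.2.1 \in B].

Lemma nb_sym e f : e \in S -> f \in nb e -> e \in nb f.
Proof. by move=> eS fe; rewrite -mem_nb_sym //; move: fe; rewrite inE => /andP[]. Qed.

Lemma nb3_sym e h : e \in S -> h \in nb3 e -> e \in nb3 h.
Proof.
move=> eS /bigcupP[f fe /bigcupP[g gf hg]].
have fS := subsetP (nb_sub ends S e) _ fe; have gS := subsetP (nb_sub ends S f) _ gf.
apply/bigcupP; exists g; first exact: nb_sym.
by apply/bigcupP; exists f; apply: nb_sym.
Qed.

Lemma card_nb3 e : (#|nb3 e| <= N ^ 3)%N.
Proof.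
have aN f := card_nb_le card_ends degS f.
apply: leq_trans (card_bigcup_le (b := (N * N)%N) _) _ => [f _|].
  apply: leq_trans (card_bigcup_le (b := N) _) _ => [g _|]; first exact: aN.
  by rewrite leq_mul2r aN orbT.
by rewrite expnS -mulnn leq_mul2r aN orbT.
Qed.

Lemma card_close v : (#|close v| <= dep)%N.
Proof.
apply: leq_trans (card_bigcup_le (b := (N ^ 3 * 3)%N) _) _ => [h _|].
  apply: leq_trans (card_bigcup_le (b := 3) _) _ => [e _|]; first by rewrite card_ends.
  by rewrite leq_mul2r card_nb3 orbT.
rewrite leq_mul2r; apply/orP; right.
apply: leq_trans (card_bigcup_le (b := (N ^ 3)%N) _) _ => [e _|]; first exact: card_nb3.
by rewrite leq_mul2r degS orbT.
Qed.

Lemma matching_dep i e :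
  depends_on [set z : L | (z.1 == i) && (z.2.1 \in nb3 e)] (fun l => e \in matching i l).
Proof.
move=> l l' eqX; apply: (trial_matching_dep card_ends (@coord_inj i)) => z.
case/imsetP => -[f j]; rewrite inE /= => fe ->.
by apply: eqX; rewrite inE /= eqxx.
Qed.

Lemma bad_dep v : depends_on (coords (ball v)) (bad v).
Proof.
move=> l l' eqX; suff hl : hits v l = hits v l' by rewrite /bad hl.
apply/setP => e; rewrite /hits /hit.
rewrite [LHS]in_set [RHS]in_set.
apply: andb_id2l => ev.
apply: eq_existsb => i; apply: andb_id2l => _.
apply: (@matching_dep i e l l') => z.
rewrite inE => /andP[_ ze]; apply: eqX; rewrite inE; apply/bigcupP.
by exists e.
Qed.

Lemma bad_indep v (X : {set V}) : [disjoint X & close v] ->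
  prob R (fun l => bad v l && all_good bad X l) = prob R (bad v) * prob R (all_good bad X).
Proof.
move=> dX; apply: (@probM_indep R L K K_gt0 (coords (ball v)) (coords (\bigcup_(w in X) ball w))).
- exact: bad_dep.
- move=> l l' eqX; apply: eq_forallb_in => w wX; rewrite (@bad_dep w l l') // => z.
  by rewrite inE => zw; apply: eqX; rewrite inE; apply/bigcupP; exists w.
rewrite -setI_eq0; apply/eqP/setP => z; rewrite !inE; apply/negP => /andP[zv /bigcupP[w wX zw]].
move/pred0P/(_ w): dX => /=; rewrite wX /= => /negP[].
case/bigcupP: zw => e; rewrite inE => /andP[eS we] ze.
by apply/bigcupP; exists z.2.1 => //; apply/bigcupP; exists e => //; apply: nb3_sym.
Qed.

(** Trials read disjoint blocks of labels and a matching has at most one edge at [v], so the moment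
    bound applies with [x = shrink]. *)
Lemma prob_bad_le v : prob R (bad v) <= failure R ^+ m.
Proof.
have DR : 0 < D%:R :> R.
  by apply: lt_le_trans mD; rewrite !mulr_gt0 ?ltr0n.
have [few|many] := leqP #|star v| (D - 28 * m).
  rewrite /prob (eq_expect (g := fun=> 0)); last by move=> l; rewrite /bad ltnNge few.
  rewrite expect_const ?card_labels_gt0 // exprn_ge0 //.
  by case/andP: (failure_bounds R) => /ltW.
pose p : R := 467 / 1250 / D%:R.
have p0 : 0 <= p by apply: divr_ge0; [lra | rewrite ler0n].
have sv : D%:R - 75 * m%:R <= #|star v|%:R :> R.
  by rewrite lerBlDr -natrM -natrD ler_nat; lia.
have svD : #|star v|%:R <= D%:R :> R by rewrite ler_nat degS.
have m0 : 0 <= m%:R :> R by rewrite ler0n.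
have rp : 2801 / (75 * 100) <= (#|star v|%:R - T%:R) * p <= 1.
  by rewrite natrM; apply: rate_bounds.
case/andP: rp => rp1 rp2.
have x0 := shrink_gt0 R; have x1 := shrink_le1 R.
pose A i e l := e \in matching i l.
pose X i : {set L} := [set z : L | z.1 == i].
have once i l e f : e \in star v -> f \in star v -> A i e l -> A i f l -> e = f.
  rewrite !inE => /andP[_ ve] /andP[_ vf] Ae Af; apply/eqP; apply: contraT => ef.
  have := trial_matching_disj (@coord_inj i) Ae Af ef.
  by move=> H; exfalso; move: H; apply/negP/disjPn; exists v.
have Adep i e : depends_on (X i) (A i e).
  apply: depends_onS (matching_dep (i := i) (e := e)).
  by apply/subsetP => z; rewrite !inE => /andP[].
have Xd i j : i != j -> [disjoint X i & X j].
  move=> ij; rewrite -setI_eq0; apply/eqP/setP => z; rewrite !inE.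
  by apply/negP => /andP[/eqP -> /eqP ji]; rewrite ji eqxx in ij.
have Ap i e : e \in star v -> p <= prob R (A i e).
  rewrite inE => /andP[eS _].
  exact: (prob_trial_ge card_ends degS K_gt0 (@coord_inj i) eS K_large).
have r0 : 0 <= 1 - (1 - shrink R) * ((#|star v|%:R - T%:R) * p).
  rewrite subr_ge0 -[leRHS]mul1r; apply: ler_pM; lra.
have := prob_few_hits K_gt0 once Adep Xd Ap p0 (ltW x0) x1 r0 (28 * m).
set rate := 1 - _ => H.
have : shrink R ^+ (28 * m) * prob R (bad v) <= hit_rate R ^+ (75 * m).
  apply: (@le_trans _ _ (rate ^+ (75 * m))).
    apply: le_trans H; rewrite ler_wpM2l ?exprn_ge0 ?(ltW x0) //.
    by apply: le_prob => l /andP[].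
  rewrite lerXn2r ?nnegrE ?(ltW (hit_rate_gt0 R)) //.
  by rewrite /rate /hit_rate lerD2l lerN2 ler_wpM2l // subr_ge0.
rewrite /failure expr_div_n -!exprM mulrC -ler_pdivlMr ?exprn_gt0 //.
Qed.

(** The matchings may overlap; the degree drop is measured by the distinct edges in [hits]. *)
Lemma color_step : exists M : 'I_T -> {set E},
  [/\ forall i, M i \subset S,
      forall i e f, e \in M i -> f \in M i -> e != f -> disj ends e f &
      forall v, (#|[set e in S :\: \bigcup_i M i | v \in ends e]| <= D - 28 * m)%N].
Proof.
have D0 : (0 < D)%N.
  by rewrite -(ltr0n R); apply: lt_le_trans mD; rewrite !mulr_gt0 ?ltr0n.
have dep0 : (0 < dep)%N by rewrite !(muln_gt0, expn_gt0) D0.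
have bad1 v : 4 * dep%:R * prob R (bad v) <= 1.
  by apply: le_trans rare; rewrite ler_wpM2l ?prob_bad_le // mulr_ge0 // ler0n.
have [l good] := local_lemma (card_labels_gt0 L K_gt0) dep0 card_close bad_indep bad1.
exists (fun i => matching i l); split => [i|i e f|v].
- exact: trial_matching_sub.
- exact: (trial_matching_disj (@coord_inj i)).
have -> : [set e in S :\: \bigcup_i matching i l | v \in ends e] = star v :\: hits v l.
  apply/setP => e; rewrite !inE.
  case eS: (e \in S); rewrite ?andbF //=; case ve: (v \in ends e); rewrite ?andbF ?andbT //=.
  congr (~~ _); apply/bigcupP/existsP => [[i _ ei]|[i /andP[_ ei]]]; exists i => //.
  by rewrite ltn_ord.
have hs : hits v l \subset star v by apply/subsetP => e; rewrite in_set => /andP[].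
rewrite cardsD (setIidPr hs).
have := good v; rewrite negb_and -leqNgt -ltnNge => /orP[few|many].
  exact: leq_trans (leq_subr _ _) few.
by have := degS v; rewrite -/(star v); lia.
Qed.

End Step.


(** * Greedy colouring and iteration *)

Section Colorable.
Variables (V E : finType) (ends : E -> {set V}).
Hypothesis card_ends : forall e, #|ends e| = 3%N.
Implicit Types (S : {set E}) (e f : E).

Definition colorable_on S k := exists c : E -> nat,
  (forall e, e \in S -> (c e < k)%N) /\
  (forall e f, e \in S -> f \in S -> e != f -> ~~ disj ends e f -> c e != c f).

Lemma greedy_colorable S D :
  (forall v, #|[set f in S | v \in ends f]| <= D)%N -> colorable_on S (3 * D).
Proof.
have [n] := ubnP #|S|; elim: n S => // n IHn S Sn degS.
have [->|[e eS]] := set_0Vmem S.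
  by exists (fun=> 0%N); split => [e|e f]; rewrite inE.
have SeS : S :\ e \subset S by apply: subsetDl.
have [||c [cN cP]] := IHn (S :\ e).
- by move: Sn; rewrite (cardsD1 e S) eS.
- by move=> v; apply: deg_sub degS _ _ SeS.
pose used := [seq c f | f <- enum (nb ends S e :\ e)].
have size_used : (size used < 3 * D)%N.
  rewrite size_map -cardE; have := card_nb_le card_ends degS e.
  by rewrite (cardsD1 e (nb ends S e)) mem_nb.
have [k kN ku] : exists2 k, (k < 3 * D)%N & k \notin used.
  case: (boolP (all (mem used) (iota 0 (3 * D)))) => [/allP sub|].
    have := uniq_leq_size (iota_uniq 0 (3 * D)) sub.
    by rewrite size_iota leqNgt size_used.
  case/allPn => k; rewrite mem_iota add0n => /andP[_ kN] ku.
  by exists k.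
have fresh f : f \in S -> f != e -> ~~ disj ends e f -> c f != k.
  move=> fS fe ef; apply: contraNneq ku => <-; apply/map_f.
  by rewrite mem_enum !inE fe fS ef.
exists (fun f => if f == e then k else c f); split => [f fS|f g fS gS fg nfg].
  by case: eqP => // /eqP fe; apply: cN; rewrite !inE fe.
case: (eqVneq f e) => [fe|fe]; case: (eqVneq g e) => [ge|ge].
- by rewrite fe ge eqxx in fg.
- by rewrite eq_sym; apply: fresh => //; rewrite -fe.
- by apply: fresh => //; rewrite -ge disj_sym.
- by apply: cP => //; rewrite !inE ?fe ?ge.
Qed.

Lemma colorable_add S T k (M : 'I_T -> {set E}) :
    (forall i e f, e \in M i -> f \in M i -> e != f -> disj ends e f) ->
    colorable_on (S :\: \bigcup_i M i) k ->
  colorable_on S (T + k).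
Proof.
move=> Md [c [ck cP]].
pose c' e := if [pick i | e \in M i] is Some i then i : nat else (T + c e)%N.
have rest e : e \in S -> (forall i, (e \in M i) = false) -> e \in S :\: \bigcup_i M i.
  by move=> eS none; rewrite inE eS andbT; apply/bigcupP => -[i _]; rewrite none.
exists c'; split => [e eS|e f eS fS ef nef]; rewrite /c'.
  case: pickP => [i _|none]; first by rewrite ltn_addr.
  by rewrite ltn_add2l ck // rest.
case: pickP => [i ei|nonee]; case: pickP => [j fj|nonef].
- apply: contraNneq nef => /val_inj ij; rewrite -ij in fj; exact: Md ei fj ef.
- by rewrite neq_ltn ltn_addr.
- by rewrite neq_ltn ltn_addr ?orbT.
- by rewrite eqn_add2l cP // rest.
Qed.

End Colorable.

(** The invariant [28k <= 75D + C] is preserved exactly when [75m] colours lower [D] by [28m]. [C]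
    pays for the greedy colouring once [D] is too small for the local lemma. *)
Lemma colorable_linear (R : archiRealFieldType) : exists C : nat,
  forall (V E : finType) (ends : E -> {set V}) (D : nat) (S : {set E}),
    (forall e, #|ends e| = 3%N) ->
    (forall v, #|[set f in S | v \in ends f]| <= D)%N ->
  exists2 k, (28 * k <= 75 * D + C)%N & colorable_on ends S k.
Proof.
have [Q QE] : exists Q : nat, Q%:R = 750 * 1000 :> R.
  by exists (750 * 1000)%N; rewrite natrM.
have Q0 : (0 < Q)%N by rewrite -(ltr0n R) QE mulr_gt0 ?ltr0n.
(* Four times the dependency degree is [4 * 3^7 * D^7], and [D <= Q (m + 1)]. *)
pose c : R := 4 * 3 ^+ 7 * Q%:R ^+ 7.
have c0 : 0 <= c by rewrite !mulr_ge0 ?exprn_ge0 ?ler0n.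
have [m0 rare] := geometric_beats_degree7 (failure_bounds R) c0.
pose D1 := (Q * m0.+1)%N; exists (28 * (3 * D1))%N => V E ends D S card_ends.
have [n] := ubnP D; elim: n D S => // n IHn D S Dn degS.
have [small|large] := ltnP D D1.
  exists (3 * D)%N; last exact: greedy_colorable.
  by apply: leq_trans (leq_addl _ _); rewrite !leq_mul2l ltnW // orbT.
pose m := (D %/ Q)%N.
have m0m : (m0 < m)%N by rewrite /m leq_divRL // mulnC.
have mQD : (Q * m <= D)%N by rewrite mulnC leq_trunc_div.
have DQm : D%:R <= Q%:R * m.+1%:R :> R.
  by rewrite -natrM ler_nat mulnC ltnW // ltn_ceil.
have D0 : (0 < D)%N by apply: leq_trans mQD; rewrite muln_gt0 Q0 (leq_ltn_trans _ m0m).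
pose big : R := 100 * 1000 * (3 * D)%:R ^+ 4.
have big0 : 0 <= big by rewrite !mulr_ge0 ?exprn_ge0 ?ler0n.
pose K := (Num.Def.archi_bound big).+1.
have KK : big <= K%:R by apply: ltW; apply: lt_trans (archi_boundP big0) _; rewrite ltr_nat.
have mD : 750 * 1000 * m%:R <= D%:R :> R by rewrite -QE -natrM ler_nat.
have rare' : 4 * (D * (3 * D) ^ 3 * ((3 * D) ^ 3 * 3))%:R * failure R ^+ m <= 1.
  apply: le_trans (rare m (ltnW m0m)).
  rewrite ler_wpM2r ?exprn_ge0 //; first by case/andP: (failure_bounds R) => /ltW.
  have -> : 4 * (D * (3 * D) ^ 3 * ((3 * D) ^ 3 * 3))%:R = 4 * 3 ^+ 7 * D%:R ^+ 7 :> R.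
    by rewrite !natrM; ring.
  rewrite /c -[leRHS]mulrA -exprMn ler_wpM2l ?mulr_ge0 ?exprn_ge0 ?ler0n //.
  by rewrite lerXn2r // nnegrE ?mulr_ge0 ?ler0n.
have [M [_ Md Mdeg]] := color_step card_ends degS (ltn0Sn _) (leq_ltn_trans (leq0n _) m0m)
  mD KK rare'.
have mD' : (28 * m <= D)%N.
  apply: leq_trans mQD; rewrite leq_mul2r; apply/orP; right.
  by rewrite -(ler_nat R) QE; lra.
have [|k kD colk] := IHn (D - 28 * m)%N (S :\: \bigcup_i M i) _ Mdeg.
  by move: Dn m0m D0; clear; lia.
exists (75 * m + k)%N; last exact: colorable_add Md colk.
by move: kD mD'; clear; lia.
Qed.

Lemma colorable_chromatic (H : hypergraph) k :
  colorable_on (@ends H) [set: edge H] k -> (chromatic_index H <= k)%N.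
Proof.
case=> c [ck cP]; rewrite /chromatic_index; case: ex_minnP => n _; apply.
have ckT e : (c e < k)%N by apply: ck; rewrite inE.
apply/existsP; exists [ffun e => Ordinal (ckT e)]; apply/forallP => e; apply/forallP => f.
rewrite !ffunE setI_eq0; apply/implyP => /andP[ef nef].
by apply: contra (cP e f (in_setT _) (in_setT _) ef nef) => /eqP[->].
Qed.

Theorem theorem1p3 (R : realType) :
  (forall iota : R, 0 < iota ->
     exists D0 : R, forall (D : R) (H : hypergraph),
       D0 <= D -> k_uniform 3 H -> t_simple 3 H -> (max_degree H)%:R <= D ->
       (chromatic_index H)%:R <= (1 - 1 / 9 + 1 / 3 ^+ 5 + iota) * (3 * D))
  /\
  (* 267 / 10 ^+ 2 + 91 / 10 ^+ 4 = 2.6791 *)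
  (exists D0 : R, forall (D : R) (H : hypergraph),
     D0 <= D -> k_uniform 3 H -> t_simple 3 H -> (max_degree H)%:R <= D ->
     (chromatic_index H)%:R <= (267 / 10 ^+ 2 + 91 / 10 ^+ 4) * D).
Proof.
have [C colC] := colorable_linear R.
have bound (D : R) (H : hypergraph) : k_uniform 3 H -> (max_degree H)%:R <= D ->
    28 * (chromatic_index H)%:R <= 75 * D + C%:R.
  move=> unif degD; have [|k kC /colorable_chromatic chi] :=
    colC (vertex H) (edge H) (@ends H) (max_degree H) [set: edge H] unif.
    move=> v; rewrite -[leqRHS]/(\max_v degree v); apply: leq_trans (leq_bigmax v).
    by apply: subset_leq_card; apply/subsetP => e; rewrite !inE.
  have : (28 * chromatic_index H <= 75 * max_degree H + C)%N.
    by apply: leq_trans kC; rewrite leq_mul2l chi.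
  by rewrite -(ler_nat R) natrD !natrM; lra.
have C0 : 0 <= C%:R :> R by rewrite ler0n.
(* Since [217 * 28 - 75 * 81 = 1], the bound [(75 D + C) / 28 <= 217 / 81 * D] holds exactly when
   [D >= 81 C]. As [2.6791 > 217 / 81], the same threshold serves both claims. *)
split=> [iota iota0|]; exists (81 * C%:R) => D H D0 unif _ degD.
  have := bound D H unif degD.
  have : 0 <= iota * D by apply: mulr_ge0; lra.
  have -> : 3 ^+ 5 = 243 :> R by ring.
  lra.
have := bound D H unif degD.
have -> : 10 ^+ 2 = 100 :> R by ring.
have -> : 10 ^+ 4 = 100 * 100 :> R by ring.
lra.
Qed.
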